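(* Let $f \colon (\mathbb{C}^2, 0) \to (\mathbb{C}, 0)$ be an analytic function germ which is mini-regular in $x$ of order $m$, and let $\xi_1, \ldots, \xi_r$ $(r \ge 2)$ be its distinct Newton--Puiseux roots. Then $$\mathcal{Q}(f) = \left\{\mathrm{ord}\, f(\xi_{i,j}(y),y) \mid 1 \le i < j \le r \right\},$$ where $\mathcal{Q}(f)$ is the set of polar quotients of $f$ and $\xi_{i,j}$ denotes the approximation of $\xi_i$ and $\xi_j$.
   Context: Germs are not assumed reduced. Write the Taylor expansion $f = f_m + f_{m+1} + \cdots$ with $f_k$ homogeneous of degree $k$ and $f_m \not\equiv 0$; $f$ is mini-regular in $x$ of order $m$ if $f_m(1,0) \neq 0$. A Newton--Puiseux root of $g=0$ (for an analytic germ $g(x,y)$ at the origin) is a convergent Puiseux series $\gamma(y) \in \mathbb{C}\{y^{1/N}\}$ (some integer $N \ge 1$) with only positive exponents (the zero series is allowed) such that $g(\gamma(y), y) \equiv 0$. Newton--Puiseux roots of $f$ are those of $f = 0$; they are counted as distinct when they are distinct as series. For a Puiseux series, $\mathrm{ord}$ denotes the smallest exponent occurring with nonzero coefficient. A polar branch of $f$ is a Newton--Puiseux root of $\frac{\partial f}{\partial x} = 0$. $\Gamma(f)$ denotes the set of polar branches that are not roots of $f = 0$. The set of polar quotients is $\mathcal{Q}(f) := \{\mathrm{ord}\, f(\gamma(y), y) \mid \gamma \in \Gamma(f)\}$. For a Puiseux series $\gamma(y) = \sum_i a_i y^{\alpha_i}$ and a positive real number $\rho$, the $\rho$-approximation of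 $\gamma$ is the series $\sum_{\alpha_i < \rho} a_i y^{\alpha_i} + g y^{\rho}$, where $g$ is a generic constant in $\mathbb{C}$ (i.e. outside a finite set of exceptional values, so that the orders considered do not depend on $g$). For two distinct Puiseux series $\gamma_1, \gamma_2$, the approximation of $\gamma_1$ and $\gamma_2$ is the $\rho$-approximation of $\gamma_1$ (equivalently of $\gamma_2$) with $\rho := \mathrm{ord}(\gamma_1(y) - \gamma_2(y))$, the contact order of $\gamma_1$ and $\gamma_2$. *)

(* Defs.v *)
From mathcomp Require Import all_boot all_order all_algebra.
From mathcomp Require Import all_classical all_reals all_analysis.
From mathcomp Require Import complex.
Set Implicit Arguments.
Unset Strict Implicit.
Unset Printing Implicit Defensive.
Import Order.TTheory GRing.Theory Num.Theory.

Local Open Scope classical_set_scope.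
Local Open Scope ring_scope.
Local Open Scope complex_scope.

(* An analytic germ (C^2, 0) -> C is an element of C{x, y}: f i j is the      *)
(* coefficient of x^i y^j, and the expansion converges absolutely on a        *)
(* nontrivial polydisc.                                                       *)
Definition analytic_germ (R : realType) (f : nat -> nat -> R[i]) : Prop :=
  exists2 e : R, 0 < e &
    (\esum_(p in [set: nat * nat])
       (ComplexField.Normc.normc (f p.1 p.2) * e ^+ (p.1 + p.2))%:E < +oo)%E.

Definition homogeneous_part (R : realType) (f : nat -> nat -> R[i])
    (k : nat) (x y : R[i]) : R[i] :=
  \sum_(i < k.+1) f i (k - i)%N * x ^+ i * y ^+ (k - i).

Definition mini_regular (R : realType) (f : nat -> nat -> R[i])
    (m : nat) : Prop :=
  (forall i j : nat, (i + j < m)%N -> f i j = 0) /\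
  homogeneous_part f m 1 0 != 0.

Definition partial_x (R : realType) (f : nat -> nat -> R[i]) :
    nat -> nat -> R[i] :=
  fun i j => f i.+1 j *+ i.+1.

(* A series in y with rational exponents is given by its coefficients         *)
(* s : rat -> R[i], so that equality of series does not depend on the choice  *)
(* of a common denominator N of the exponents. The radius e below is in the   *)
(* variable y^(1/N).                                                          *)
Definition convergent_puiseux (R : realType) (s : rat -> R[i]) : Prop :=
  exists2 N : nat, (0 < N)%N &
    (forall q : rat, s q != 0 -> exists n : nat, q = n%:R / N%:R) /\
    (exists2 e : R, 0 < e &
      (\esum_(n in [set: nat])
         (ComplexField.Normc.normc (s (n%:R / N%:R)) * e ^+ n)%:E < +oo)%E).

(* The sums over [set: _] below are sums of finitely supported families       *)
(* (fsbigop): they are finite when the exponents of the series lie in         *)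
(* (1/N)Z and are nonnegative, resp. positive for the substitution.           *)
Definition series_mul (R : realType) (s t : rat -> R[i]) : rat -> R[i] :=
  fun q => \sum_(p \in [set: rat]) s p * t (q - p).

Definition series_exp (R : realType) (s : rat -> R[i]) (n : nat) :
    rat -> R[i] :=
  iter n (series_mul s) (fun q => (q == 0)%:R).

(* The series g(s(y), y). *)
Definition series_subst (R : realType) (g : nat -> nat -> R[i])
    (s : rat -> R[i]) : rat -> R[i] :=
  fun q => \sum_(p \in [set: nat * nat])
             g p.1 p.2 * series_exp s p.1 (q - p.2%:R).

(* The smallest exponent occurring in s, and +oo for the zero series. *)
Definition series_ord (R : realType) (s : rat -> R[i]) : \bar rat :=
  xget +oo%E
    [set o : \bar rat | exists q : rat,
       [/\ o = q%:E, s q != 0 & forall p : rat, s p != 0 -> q <= p]].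

Definition newton_puiseux_root (R : realType) (g : nat -> nat -> R[i])
    (s : rat -> R[i]) : Prop :=
  [/\ convergent_puiseux s,
      forall q : rat, s q != 0 -> 0 < q &
      forall q : rat, series_subst g s q = 0].

Definition polar_branch (R : realType) (f : nat -> nat -> R[i])
    (s : rat -> R[i]) : Prop :=
  newton_puiseux_root (partial_x f) s.

Definition polar_quotients (R : realType) (f : nat -> nat -> R[i]) :
    set (\bar rat) :=
  [set series_ord (series_subst f s) | s in
     [set s | polar_branch f s /\ ~ newton_puiseux_root f s]].

(* Contact orders of Puiseux series are rational, so only rational rho occur. *)
Definition approximation (R : realType) (s : rat -> R[i]) (rho : rat)
    (c : R[i]) : rat -> R[i] :=
  fun q => if q < rho then s q else if q == rho then c else 0.

Definition contact_order (R : realType) (s t : rat -> R[i]) : rat :=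
  fine (series_ord (s \- t)).

(* The value of F c for all c outside a finite set; +oo if there is none. *)
Definition generic_value (R : realType) (F : R[i] -> \bar rat) : \bar rat :=
  xget +oo%E [set o : \bar rat | finite_set [set c : R[i] | F c != o]].

Definition approximation_ord (R : realType) (f : nat -> nat -> R[i])
    (s t : rat -> R[i]) : \bar rat :=
  generic_value (fun c : R[i] =>
    series_ord (series_subst f (approximation s (contact_order s t) c))).

(* Main.v *)
(* Work in the complete ring of series in t = y whose nonnegative rational    *)

(* The lemmas that carry this argument are as follows. [series_substE] turns substitution of a
   series without constant term into evaluation [ev] in the complete ring, where [taylor] recentres
   a germ at the base series. [initial_form] produces the edge polynomial P, and [newton_data]
   collects what one edge says about f and its x-derivative simultaneously. Roots of P lift by
   [newton_step_root], whose engine is [newton_puiseux]: by induction on the order of regularity in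
   x, a Tschirnhaus shift kills the subleading coefficient, after which every root of the edge
   polynomial has smaller multiplicity. The two inclusions each rest on one fact about polynomials
   in characteristic zero: [deriv_root_not_root] leads from two roots to a polar branch,
   [second_root] from a polar branch to two roots. [approximation_ordE] identifies h with the
   generic order along the approximation. The work is formal throughout; [newton_puiseux_rootE],
   through [root_convergent], shows that the formal roots are exactly the convergent ones. *)
(* exponents are finite in number below any bound. For a base series phi and  *)
(* a slope rho > 0 write                                                      *)
(*   f(phi + w y^rho, y) = y^h (P(w) + terms of positive order)               *)
(* with P a nonzero polynomial. Then f(phi + w y^rho, y) has order h exactly  *)
(* when P does not vanish at w(0), roots of P lift to Newton-Puiseux roots of *)
(* f, and f_x has the initial form P', so roots of P' lift to polar branches. *)
(* If two roots of f have contact order rho, take phi to be one of them: P    *)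
(* has two distinct roots, hence P' has a root that is not a root of P, and   *)
(* lifting it gives a polar branch along which f has order h.                 *)
(* Conversely, if phi is a polar branch that is not a root of f and rho is    *)
(* its largest contact order with a root of f, then P(0) <> 0, P'(0) = 0 and  *)
(* P has a root; so P has two distinct roots, which lift to roots of f with   *)
(* contact order rho whose approximation gives the order h.                   *)
(* Formal roots converge because each is a simple root of some iterated       *)
(* x-derivative of f, to which a majorant form of the implicit function       *)
(* theorem applies.                                                           *)
Require Import Defs.
From mathcomp Require Import all_boot all_order all_algebra.
From mathcomp Require Import all_classical all_reals all_analysis.
From mathcomp Require Import complex.
From HB Require Import structures.
From mathcomp Require Import ring lra zify.

Set Implicit Arguments.
Unset Strict Implicit.
Unset Printing Implicit Defensive.
Import Order.TTheory GRing.Theory Num.Theory.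

Local Open Scope classical_set_scope.
Local Open Scope ring_scope.
Local Open Scope complex_scope.

(** * The ring of Levi-Civita series *)

Section Convolution.
Variable K : fieldType.
Implicit Types s t u : rat -> K.

(** The body is that of [series_mul] over any field, so that powers in [lcseries] agree with
    [series_exp] by conversion. *)
Definition conv s t : rat -> K :=
  fun q => \sum_(p \in [set: rat]) s p * t (q - p).

Lemma conv_seq (r : seq rat) s t q : uniq r ->
  (forall p, s p != 0 -> t (q - p) != 0 -> p \in r) ->
  conv s t q = \sum_(p <- r) s p * t (q - p).
Proof.
move=> ur hr; rewrite /conv (fsbigE r) //.
  by rewrite big_mkcond /=; apply: eq_bigr => p _; rewrite in_setT.
move=> p _; apply: contraNeq; rewrite mulf_eq0 negb_or => /andP[].
exact: hr.
Qed.

Definition left_finite s :=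
  (forall q, q < 0 -> s q = 0) /\
  forall b, exists r : seq rat, forall q, q < b -> s q != 0 -> q \in r.

Lemma left_finite_le s b : left_finite s ->
  exists2 r : seq rat, uniq r & forall q, q <= b -> s q != 0 -> q \in r.
Proof.
move=> [_ /(_ (b + 1))[r hr]]; exists (undup r); first exact: undup_uniq.
by move=> q qb sq; rewrite mem_undup hr // (le_lt_trans qb) // ltrDl.
Qed.

Lemma left_finite_ge0 s q : left_finite s -> s q != 0 -> 0 <= q.
Proof.
by move=> [s0 _]; apply: contraNT; rewrite -ltNge => /s0 ->.
Qed.

Lemma conv_left_finite s t : left_finite s -> left_finite t ->
  left_finite (conv s t).
Proof.
move=> ls lt; split=> [q q0|b].
  rewrite (@conv_seq [::]) ?big_nil // => p sp tp; exfalso.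
  have := left_finite_ge0 ls sp; have := left_finite_ge0 lt tp; lra.
have [rs us hs] := left_finite_le b ls; have [rt ut ht] := left_finite_le b lt.
exists [seq p + p' | p <- rs, p' <- rt] => q qb.
rewrite (@conv_seq rs) //; last first.
  move=> p sp tp; apply: hs => //; have := left_finite_ge0 lt tp; lra.
apply: contraNT => hq; apply/eqP; rewrite big_seq big1 // => p prs.
apply/eqP; apply: contraNT hq; rewrite mulf_eq0 negb_or => /andP[sp tp].
apply/allpairsP; exists (p, q - p); split => //=; last by ring.
apply: ht => //; have := left_finite_ge0 ls sp; lra.
Qed.

Lemma convC s t : left_finite s -> left_finite t -> conv s t = conv t s.
Proof.
move=> ls lt; apply/funext => q.
have [rs us hs] := left_finite_le q ls; have [rt ut ht] := left_finite_le q lt.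
pose r := undup (rs ++ [seq q - p | p <- rt]).
rewrite (@conv_seq r) ?undup_uniq //; last first.
  move=> p sp tp; rewrite mem_undup mem_cat hs //.
  have := left_finite_ge0 lt tp; lra.
rewrite (@conv_seq [seq q - p | p <- r]).
- by rewrite big_map; apply: eq_bigr => p _; rewrite subKr mulrC.
- by rewrite map_inj_uniq ?undup_uniq // => x y /addrI /oppr_inj.
move=> p tp sp; apply/mapP; exists (q - p); last by rewrite subKr.
rewrite mem_undup mem_cat; apply/orP; left; apply: hs => //.
have := left_finite_ge0 lt tp; lra.
Qed.

Lemma convA s t u : left_finite s -> left_finite t -> left_finite u ->
  conv s (conv t u) = conv (conv s t) u.
Proof.
move=> ls lt lu; apply/funext => q.
have [rs us hs] := left_finite_le q ls; have [rt ut ht] := left_finite_le q lt.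
have lst := conv_left_finite ls lt.
pose r := undup [seq p + p' | p <- rs, p' <- rt].
have hr p p' : p <= q -> p' <= q -> p + p' <= q -> s p != 0 -> t p' != 0 ->
    p + p' \in r.
  move=> pq p'q _ sp tp; rewrite mem_undup; apply/allpairsP.
  by exists (p, p'); split; [apply: hs|apply: ht|].
rewrite (@conv_seq rs) //; last first.
  move=> p sp tu; apply: hs => //.
  have := left_finite_ge0 (conv_left_finite lt lu) tu; lra.
rewrite (@conv_seq r) ?undup_uniq //; last first.
  move=> p stp up; have pq : p <= q by have := left_finite_ge0 lu up; lra.
  move: stp; rewrite (@conv_seq rs) //; last first.
    move=> p' sp tp; apply: hs => //; have := left_finite_ge0 lt tp; lra.
  apply: contraNT => pr; apply/eqP; rewrite big1 // => p' _.
  apply/eqP; apply: contraNT pr; rewrite mulf_eq0 negb_or => /andP[sp tp].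
  have -> : p = p' + (p - p') by ring.
  have := left_finite_ge0 ls sp; have := left_finite_ge0 lt tp.
  by move=> ? ?; apply: hr => //; lra.
transitivity (\sum_(p <- rs) \sum_(p' <- r) s p * (t (p' - p) * u (q - p'))).
  apply: eq_bigr => p _; rewrite -mulr_sumr.
  have [->|sp] := eqVneq (s p) 0; first by rewrite !mul0r.
  congr (_ * _); rewrite (@conv_seq [seq p' - p | p' <- r]); first last.
  - move=> p' tp up; apply/mapP; exists (p + p'); last by ring.
    have := left_finite_ge0 ls sp; have := left_finite_ge0 lt tp.
    have := left_finite_ge0 lu up.
    by move=> ? ? ?; apply: hr => //; lra.
  - by rewrite map_inj_uniq ?undup_uniq // => x y /addIr.
  rewrite big_map; apply: eq_bigr => p' _; congr (_ * u _); ring.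
rewrite exchange_big; apply: eq_bigr => p' _ /=.
have [->|up] := eqVneq (u (q - p')) 0.
  by rewrite mulr0 big1 // => p _; rewrite !mulr0.
rewrite (@conv_seq rs) //; last first.
  move=> p sp tp; apply: hs => //; have := left_finite_ge0 lt tp.
  have := left_finite_ge0 lu up; lra.
by rewrite mulr_suml; apply: eq_bigr => p _; rewrite mulrA.
Qed.

End Convolution.

(* The series with nonnegative rational exponents of the Levi-Civita field,   *)
(* i.e. those having finitely many exponents below any bound: this ring is    *)
(* complete, and no common denominator has to be tracked.                     *)
Record lcseries (K : fieldType) :=
  LCSeries { lccoef :> rat -> K; _ : left_finite lccoef }.

Section LCSeriesRing.
Variable K : fieldType.
Local Notation lc := (lcseries K).
Implicit Types s t u : lc.

Lemma lcseriesP s : left_finite s. Proof. by case: s. Qed.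
Hint Resolve lcseriesP : core.

Lemma lcseries_eq s t : (forall q, s q = t q) -> s = t.
Proof.
case: s t => [s hs] [t ht] /= /funext st; rewrite st in hs *.
by congr LCSeries; apply: Prop_irrelevance.
Qed.

HB.instance Definition _ := gen_eqMixin lc.
HB.instance Definition _ := gen_choiceMixin lc.

Fact lcadd_subproof s t : left_finite (fun q => s q + t q).
Proof.
have [s0 ls] := lcseriesP s; have [t0 lt] := lcseriesP t; split=> [q q0|b].
  by rewrite s0 ?t0 ?addr0.
have [rs hs] := ls b; have [rt ht] := lt b; exists (rs ++ rt) => q qb.
rewrite mem_cat; apply: contraNT => /norP[qs qt].
have [sq|/(hs _ qb)] := eqVneq (s q) 0; last by rewrite (negbTE qs).
have [tq|/(ht _ qb)] := eqVneq (t q) 0; last by rewrite (negbTE qt).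
by rewrite sq tq addr0.
Qed.
Definition lcadd s t := LCSeries (lcadd_subproof s t).

Fact lcopp_subproof s : left_finite (fun q => - s q).
Proof.
have [s0 ls] := lcseriesP s; split=> [q q0|b]; first by rewrite s0 ?oppr0.
by have [r hr] := ls b; exists r => q qb; rewrite oppr_eq0; apply: hr.
Qed.
Definition lcopp s := LCSeries (lcopp_subproof s).

Fact lcmono_subproof (c : K) h :
  left_finite (fun q => if (q == h) && (0 <= h) then c else 0).
Proof.
split=> [q q0|b].
  by case: eqP => //= <-; rewrite leNgt q0.
by exists [:: h] => q _; case: (eqVneq q h) => [->|]; rewrite ?inE ?eqxx.
Qed.
(* The monomial c t^h; the junk value for h < 0 is 0. *)
Definition lcmono (c : K) h : lc := LCSeries (lcmono_subproof c h).

Definition lcmul s t := LCSeries (conv_left_finite (lcseriesP s) (lcseriesP t)).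

Fact lcaddA : associative lcadd.
Proof. by move=> s t u; apply: lcseries_eq => q /=; rewrite addrA. Qed.
Fact lcaddC : commutative lcadd.
Proof. by move=> s t; apply: lcseries_eq => q /=; rewrite addrC. Qed.
Fact lcadd0 : left_id (lcmono 0 0) lcadd.
Proof. by move=> s; apply: lcseries_eq => q /=; rewrite if_same add0r. Qed.
Fact lcaddN : left_inverse (lcmono 0 0) lcopp lcadd.
Proof. by move=> s; apply: lcseries_eq => q /=; rewrite if_same addNr. Qed.

HB.instance Definition _ :=
  GRing.isZmodule.Build lc lcaddA lcaddC lcadd0 lcaddN.

Lemma lcmono_conv (c : K) h s q : 0 <= h -> conv (lcmono c h) s q = c * s (q - h).
Proof.
move=> h0; rewrite (@conv_seq _ [:: h]) //; last first.
  by move=> p /=; case: (eqVneq p h) => [->|]; rewrite ?inE ?eqxx.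
by rewrite big_seq1 /= eqxx h0.
Qed.

Fact lcmulA : associative lcmul.
Proof. by move=> s t u; apply: lcseries_eq => q /=; rewrite convA. Qed.
Fact lcmulC : commutative lcmul.
Proof. by move=> s t; apply: lcseries_eq => q /=; rewrite convC. Qed.
Fact lcmul1 : left_id (lcmono 1 0) lcmul.
Proof.
by move=> s; apply: lcseries_eq => q; rewrite /= lcmono_conv // mul1r subr0.
Qed.
Fact lcmulDl : left_distributive lcmul +%R.
Proof.
move=> s t u; apply: lcseries_eq => q /=.
have [rs _ hs] := left_finite_le q (lcseriesP s).
have [rt _ ht] := left_finite_le q (lcseriesP t).
have hr p : s p != 0 \/ t p != 0 -> u (q - p) != 0 -> p \in undup (rs ++ rt).
  rewrite mem_undup mem_cat => sp /(left_finite_ge0 (lcseriesP u));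
    rewrite subr_ge0 => pq.
  by case: sp => sp; [rewrite hs|rewrite orbC ht].
rewrite !(@conv_seq _ (undup (rs ++ rt))) ?undup_uniq //.
- by rewrite -big_split; apply: eq_bigr => p _; rewrite mulrDl.
- by move=> p sp; apply: hr; right.
- by move=> p sp; apply: hr; left.
move=> p; have [->|sp _] := eqVneq (s p) 0; last by apply: hr; left.
by rewrite add0r => sp; apply: hr; right.
Qed.
Fact lcone_neq0 : lcmono 1 0 != 0.
Proof.
by apply/eqP => /(congr1 (fun s : lc => s 0))/eqP; rewrite /= oner_eq0.
Qed.

HB.instance Definition _ :=
  GRing.Zmodule_isComNzRing.Build lc lcmulA lcmulC lcmul1 lcmulDl lcone_neq0.

Lemma lccD s t q : (s + t) q = s q + t q. Proof. by []. Qed.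
Lemma lccN s q : (- s) q = - s q. Proof. by []. Qed.
Lemma lccB s t q : (s - t) q = s q - t q. Proof. by []. Qed.
Lemma lcc0 q : (0 : lc) q = 0. Proof. by rewrite /= if_same. Qed.
Lemma lcc1 q : (1 : lc) q = (q == 0)%:R.
Proof. by rewrite /= andbT; case: eqP. Qed.
Lemma lccM s t q : (s * t) q = conv s t q. Proof. by []. Qed.
Lemma lcc_sum I (r : seq I) (P : pred I) (F : I -> lc) q :
  (\sum_(i <- r | P i) F i) q = \sum_(i <- r | P i) F i q.
Proof. by elim/big_rec2: _ => [|i x y _ <-]; rewrite ?lcc0. Qed.
Lemma lccMn s n q : (s *+ n) q = s q *+ n.
Proof. by elim: n => [|n IH]; rewrite ?mulr0n ?lcc0 // !mulrS lccD IH. Qed.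
Lemma lcc_mono (c : K) h s q : 0 <= h -> (lcmono c h * s) q = c * s (q - h).
Proof. exact: lcmono_conv. Qed.

Lemma lccM_at0 s t : (s * t) 0 = s 0 * t 0.
Proof.
rewrite lccM (@conv_seq _ [:: 0]) ?big_seq1 ?subr0 // => p sp tp.
have := left_finite_ge0 (lcseriesP s) sp; have := left_finite_ge0 (lcseriesP t) tp.
by rewrite inE => ? ?; apply/eqP; lra.
Qed.

Lemma lccX_at0 s n : (s ^+ n) 0 = s 0 ^+ n.
Proof. by elim: n => [|n IH]; rewrite ?lcc1 // !exprS lccM_at0 IH. Qed.

Lemma lcc_lt0 s q : q < 0 -> s q = 0.
Proof. by case: (lcseriesP s) => h _; apply: h. Qed.

Local Notation "''t^' h" := (lcmono 1 h) (at level 8, h at level 2).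

Lemma lcc_t h s q : 0 <= h -> ('t^h * s) q = s (q - h).
Proof. by move=> h0; rewrite lcc_mono // mul1r. Qed.

Lemma t0 : 't^0 = 1. Proof. by []. Qed.

Lemma tD h k : 0 <= h -> 0 <= k -> 't^(h + k) = 't^h * 't^k.
Proof.
move=> h0 k0; apply: lcseries_eq => q; rewrite lcc_t //= k0 addr_ge0 // !andbT.
by rewrite subr_eq addrC.
Qed.

Lemma tX h n : 0 <= h -> 't^h ^+ n = 't^(n%:R * h).
Proof.
move=> h0; elim: n => [|n IH]; first by rewrite mul0r.
by rewrite exprS IH -tD ?mulr_ge0 ?ler0n // mulrSr; congr lcmono; ring.
Qed.

Lemma tI h : 0 <= h -> injective ( *%R 't^h).
Proof.
move=> h0 s t st; apply: lcseries_eq => q.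
by have := congr1 (fun u : lc => u (q + h)) st;
  rewrite /= !lcmono_conv // !mul1r addrK.
Qed.

(** * The order filtration and completeness *)

Definition vge (b : rat) s := forall p, p < b -> s p = 0.

Lemma vge0 b : vge b 0. Proof. by move=> p _; rewrite lcc0. Qed.
Lemma vge_le b c s : vge b s -> c <= b -> vge c s.
Proof. by move=> h cb p pc; apply: h; apply: lt_le_trans pc cb. Qed.
Lemma vge_nneg b s : b <= 0 -> vge b s.
Proof. by move=> b0 p pb; apply: lcc_lt0; lra. Qed.
Lemma vgeD b s t : vge b s -> vge b t -> vge b (s + t).
Proof. by move=> hs ht p pb; rewrite lccD hs ?ht ?addr0. Qed.
Lemma vgeN b s : vge b s -> vge b (- s).
Proof. by move=> hs p pb; rewrite lccN hs ?oppr0. Qed.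
Lemma vgeB b s t : vge b s -> vge b t -> vge b (s - t).
Proof. by move=> hs /vgeN; apply: vgeD. Qed.
Lemma vgeMn b s n : vge b s -> vge b (s *+ n).
Proof. by move=> hs p pb; rewrite lccMn hs ?mul0rn. Qed.
Lemma vge_sum b I (r : seq I) (P : pred I) (F : I -> lc) :
  (forall i, P i -> vge b (F i)) -> vge b (\sum_(i <- r | P i) F i).
Proof. by move=> h p pb; rewrite lcc_sum big1 // => i Pi; rewrite h. Qed.
Lemma vgeM b c s t : vge b s -> vge c t -> vge (b + c) (s * t).
Proof.
move=> hs ht q qbc; rewrite lccM (@conv_seq _ [::]) ?big_nil // => p sp tp.
exfalso; have : b <= p by apply: contraNT sp; rewrite -ltNge => /hs ->.
have : c <= q - p by apply: contraNT tp; rewrite -ltNge => /ht ->.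
lra.
Qed.
Lemma vgeMl b s t : vge b s -> vge b (t * s).
Proof. by move=> h; rewrite -[b]add0r; apply: vgeM => //; apply: vge_nneg. Qed.
Lemma vgeMr b s t : vge b s -> vge b (s * t).
Proof. by rewrite mulrC; apply: vgeMl. Qed.
Lemma vgeX b s n : vge b s -> vge (n%:R * b) (s ^+ n).
Proof.
move=> h; elim: n => [|n IH]; first by rewrite mul0r; apply: vge_nneg.
by rewrite exprS mulrSr mulrDl mul1r addrC; apply: vgeM.
Qed.
Lemma vge_mono (c : K) h : vge h (lcmono c h).
Proof. by move=> p ph /=; rewrite lt_eqF. Qed.

Lemma vge_eq0 s : (forall b, vge b s) -> s = 0.
Proof. by move=> h; apply: lcseries_eq => q; rewrite lcc0 (h (q + 1)) ?ltrDl. Qed.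

Lemma order_exists s : s != 0 -> exists e : rat, [/\ 0 <= e, s e != 0 & vge e s].
Proof.
move=> s0; have [q sq] : exists q, s q != 0.
  by apply: contrapT => /forallNP h; case/eqP: s0; apply: lcseries_eq => q;
    rewrite lcc0; apply/eqP/negPn/negP/h.
have [r _ hr] := left_finite_le q (lcseriesP s).
have [e [er eq se he]] : exists e, [/\ e \in r, e <= q, s e != 0 &
    forall p, p \in r -> p <= q -> s p != 0 -> e <= p].
  have qr := hr q (lexx _) sq.
  case: (@Order.TotalTheory.arg_minP _ _ (seq_sub r) (SeqSub qr) (fun x => (ssval
    x <= q) && (s (ssval x) != 0)) (@ssval _ _)).
    by rewrite /= lexx sq.
  move=> [e er] /= /andP[eq se] he; exists e; split => // p pr pq sp.
  by apply: (he (SeqSub pr)); rewrite /= pq sp.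
exists e; split=> //; first exact: left_finite_ge0 se.
move=> p pe; apply/eqP; apply: contraT => sp.
have pq : p <= q by apply: le_trans (ltW pe) eq.
by have := he p (hr p pq sp) pq sp; rewrite leNgt pe.
Qed.

(** The support has a least element, so there is a gap above b. With b = 0 this yields the step e
    that governs all convergence rates below. *)
Lemma vge_pos b s : (forall p, p <= b -> s p = 0) ->
  exists2 e : rat, b < e & vge e s.
Proof.
have [->|/order_exists[e [_ se he]]] := eqVneq s 0 => [_|hb].
  by exists (b + 1); [rewrite ltrDl|apply: vge0].
by exists e => //; rewrite ltNge; apply/negP => /hb/eqP; apply/negP.
Qed.

Lemma vge_pos0 s : s 0 = 0 -> exists2 e : rat, 0 < e & vge e s.
Proof.
move=> s0; apply: vge_pos => p; rewrite le_eqVlt => /orP[/eqP ->//|].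
exact: lcc_lt0.
Qed.

Lemma at0_vge e s : 0 < e -> vge e s -> s 0 = 0.
Proof. by move=> e0; apply. Qed.

Lemma vge_divt h s : 0 <= h -> vge h s -> exists s', s = 't^h * s'.
Proof.
move=> h0 hs.
have ls : left_finite (fun q => if 0 <= q then s (q + h) else 0).
  split=> [q q0|b]; first by rewrite leNgt q0.
  have [_ /(_ (b + h))[r hr]] := lcseriesP s; exists [seq q - h | q <- r] => q qb.
  case: ifP => [_ sq|]; last by rewrite eqxx.
  by apply/mapP; exists (q + h); [apply: hr => //; lra|ring].
exists (LCSeries ls); apply: lcseries_eq => q; rewrite lcc_t //= subr_ge0 subrK.
by case: leP => // /hs.
Qed.

Lemma vge_t h s : 0 <= h -> vge h ('t^h * s).
Proof. by move=> h0; apply: vgeMr; apply: vge_mono. Qed.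

Lemma lcc_t_at h s : 0 <= h -> ('t^h * s) h = s 0.
Proof. by move=> h0; rewrite lcc_t // subrr. Qed.

Lemma vge_t_iff h b s : 0 <= h -> vge (h + b) ('t^h * s) -> vge b s.
Proof.
move=> h0 hs p pb; have := hs (p + h); rewrite lcc_t // addrK; apply; lra.
Qed.

Fact lctrunc_subproof b s : left_finite (fun q => if q < b then s q else 0).
Proof.
have [s0 ls] := lcseriesP s; split=> [q q0|c].
  by rewrite s0 // if_same.
by have [r hr] := ls c; exists r => q qb; case: ifP => _; [apply: hr|rewrite eqxx].
Qed.
Definition lctrunc b s := LCSeries (lctrunc_subproof b s).

Lemma vge_trunc b s : vge b (s - lctrunc b s).
Proof. by move=> p pb; rewrite lccB /= pb subrr. Qed.

Lemma trunc_eq b s t : vge b (s - t) -> lctrunc b s = lctrunc b t.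
Proof.
move=> h; apply: lcseries_eq => q /=; case: ifP => // qb.
by apply/eqP; rewrite -subr_eq0 -lccB h.
Qed.

Lemma rat_archi (b e : rat) : 0 < e -> exists n : nat, b < n%:R * e.
Proof.
move=> e0; exists (Num.bound `|b / e|); rewrite -ltr_pdivrMr //.
by rewrite (le_lt_trans (ler_norm _)) // archi_boundP.
Qed.

(** The coefficient at q no longer changes once q < n e, so the limit reads it off at such a stage
    [N q]. *)
Lemma lc_complete e (u : nat -> lc) : 0 < e ->
  (forall n, vge (n%:R * e) (u n.+1 - u n)) ->
  exists s, forall n, vge (n%:R * e) (s - u n).
Proof.
move=> e0 hu.
have hu' n m : (n <= m)%N -> vge (n%:R * e) (u m - u n).
  move=> /subnK <-; elim: (m - n)%N => [|k IH]; first by rewrite subrr; apply: vge0.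
  rewrite addSn -(subrK (u (k + n)) (u (k + n).+1)) -addrA; apply: vgeD => //.
  apply: (vge_le (hu _)); apply: ler_wpM2r; first exact: ltW.
  by rewrite ler_nat leq_addl.
pose N q : nat := xget 0%N [set n : nat | q < n%:R * e].
have hN q : q < (N q)%:R * e.
  rewrite /N; case: (rat_archi q e0) => n hn; case: xgetP => // h.
  by have := h n.
have hv n q : q < n%:R * e -> u (N q) q = u n q.
  move=> qn; case: (leqP n (N q)) => [nN|/ltnW nN].
    by have /eqP := hu' _ _ nN q qn; rewrite lccB subr_eq0 => /eqP.
  by have /eqP := hu' _ _ nN q (hN q); rewrite lccB subr_eq0 => /eqP.
have ls : left_finite (fun q => u (N q) q).
  split=> [q q0|b]; first exact: lcc_lt0.
  have [n hn] := rat_archi b e0; have [_ /(_ b)[r hr]] := lcseriesP (u n).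
  by exists r => q qb; rewrite (hv n) ?(lt_trans qb) //; apply: hr.
by exists (LCSeries ls) => n p pn; rewrite lccB /= (hv n) // subrr.
Qed.

End LCSeriesRing.

Local Notation "''t^' h" := (lcmono 1 h) (at level 8, h at level 2).

(** * Substitution in power series *)

Section Evaluation.
Variable K : fieldType.
Local Notation lc := (lcseries K).
Implicit Types (s t u v w : lc) (G H : nat -> lc) (b c d e h rho : rat).

Lemma ler_natM m n e : 0 < e -> (m <= n)%N -> m%:R * e <= n%:R * e.
Proof. by move=> /ltW e0 mn; apply: ler_wpM2r; rewrite ?ler_nat. Qed.

Definition psum G w n := \sum_(i < n) G i * w ^+ i.

(** The limit of the partial sums in the order topology, with default 0. The limit exists whenever w
    has positive order. *)
Definition ev G w : lc :=
  xget 0 [set s | forall b, exists M, forall n, (M <= n)%N ->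
    vge b (s - psum G w n)].

Lemma vge_nat_eq0 e s : 0 < e -> (forall n : nat, vge (n%:R * e) s) -> s = 0.
Proof.
move=> e0 h; apply: vge_eq0 => b; have [n hn] := rat_archi b e0.
by apply: (vge_le (h n)); apply: ltW.
Qed.

Lemma evP e G w n : 0 < e -> vge e w -> vge (n%:R * e) (ev G w - psum G w n).
Proof.
move=> e0 we; have [s hs] := @lc_complete K e (psum G w) e0 (fun n =>
  ltac:(rewrite /psum big_ord_recr /= addrAC subrr add0r; apply: vgeMl;
    exact: vgeX)).
rewrite /ev; case: xgetP => [u _ hu|h]; last first.
  exfalso; apply: (h s) => b; have [M hM] := rat_archi b e0; exists M => m Mm.
  apply: (vge_le (hs m)); apply: ltW; apply: lt_le_trans hM _.
  by exact: ler_natM.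
have [M hM] := hu (n%:R * e); set m := maxn M n.
have -> : u - psum G w n = (u - psum G w m) + ((s - psum G w n) - (s - psum G w m)).
  by ring.
apply: vgeD; first by apply: hM; rewrite leq_maxl.
apply: vgeB => //; apply: (vge_le (hs m)).
by apply: ler_natM; rewrite ?leq_maxr.
Qed.

Arguments evP {e} G {w} n _ _.

(** The constant loss c is harmless because n e - c is still unbounded; it absorbs the first partial
    sums in [ev_newton]. *)
Lemma ev_unique e c G w s : 0 < e -> vge e w ->
  (forall n : nat, vge (n%:R * e - c) (s - psum G w n)) -> s = ev G w.
Proof.
move=> e0 we hs; apply/eqP; rewrite -subr_eq0; apply/eqP; apply: vge_eq0 => b.
have [n hn] := rat_archi (b + `|c|) e0.
have -> : s - ev G w = (s - psum G w n) - (ev G w - psum G w n) by ring.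
have c0 := normr_ge0 c; have cc := ler_norm c.
apply: vgeB; first by apply: (vge_le (hs n)); lra.
by apply: (vge_le (evP G n e0 we)); lra.
Qed.

Lemma ev_at0 G w : w 0 = 0 -> (ev G w) 0 = G 0%N 0.
Proof.
move=> /vge_pos0[e e0 we]; have := evP G 1 e0 we.
rewrite /psum big_ord_recr big_ord0 /= add0r mulr1 mul1r => /(_ 0 e0).
by rewrite lccB => /eqP; rewrite subr_eq0 => /eqP.
Qed.

Lemma evMn G w n : w 0 = 0 -> ev (fun i => G i *+ n) w = ev G w *+ n.
Proof.
move=> /vge_pos0[e e0 we]; apply/esym/(@ev_unique e 0) => // k.
have -> : psum (fun i => G i *+ n) w k = psum G w k *+ n.
  by rewrite /psum -sumrMnl; apply: eq_bigr => i _; rewrite mulrnAl.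
by rewrite -mulrnBl subr0; apply/vgeMn/evP.
Qed.

Lemma eq_ev G H w : (forall i, G i = H i) -> ev G w = ev H w.
Proof. by move=> /funext ->. Qed.

(** Coefficients of the k-th Hasse derivative in x, that is, the k-th derivative divided by k!; for
    k = 1 it is the ordinary derivative. *)
Definition hasse G k : nat -> lc := fun i => G (i + k)%N *+ 'C(i + k, k).

Definition tshift G w : nat -> lc := fun k => ev (hasse G k) w.

Lemma hasse0 G i : hasse G 0 i = G i.
Proof. by rewrite /hasse addn0 bin0. Qed.

Lemma tshift0 G w : tshift G w 0 = ev G w.
Proof. by apply: eq_ev; apply: hasse0. Qed.

Lemma hasse1_hasse G i j : hasse (hasse G 1) i j = hasse G i.+1 j *+ i.+1.
Proof.
rewrite /hasse -!mulrnA !addn1 !addnS bin1; congr (_ *+ _).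
by rewrite [RHS]mulnC -mul_bin_diag.
Qed.

Lemma hasse1_tshift G w i : w 0 = 0 ->
  hasse (tshift G w) 1 i = tshift (hasse G 1) w i.
Proof.
move=> w0; rewrite /tshift (eq_ev w (hasse1_hasse G i)) evMn //.
by rewrite /hasse addn1 bin1.
Qed.

(** Partial sums satisfy an exact binomial identity over the triangle i + k < n, and both neglected
    tails have order at least n e. *)
Lemma taylor G u v : u 0 = 0 -> v 0 = 0 -> ev G (u + v) = ev (tshift G u) v.
Proof.
move=> /vge_pos0[e1 e10 hu1] /vge_pos0[e2 e20 hv1].
pose e := Num.min e1 e2; have e0 : 0 < e by rewrite lt_min e10.
have hu : vge e u by apply: (vge_le hu1); rewrite ge_min lexx.
have hv : vge e v by apply: (vge_le hv1); rewrite ge_min lexx orbT.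
apply: (@ev_unique e 0) => // n; rewrite subr0.
have E : psum G (u + v) n = \sum_(k < n) psum (hasse G k) u (n - k) * v ^+ k.
  elim: n => [|n IH]; first by rewrite /psum !big_ord0.
  rewrite /psum big_ord_recr /= -/(psum _ _ _) IH exprDn.
  rewrite big_ord_recr [in RHS]big_ord_recr /= mulrDr addrA; congr (_ + _).
    rewrite mulr_sumr -big_split /=; apply: eq_bigr => k _.
    rewrite subSn ?[(k <= n)%N]ltnW // /psum [in RHS]big_ord_recr /= mulrDl.
    congr (_ + _); rewrite /hasse subnK ?[(k <= n)%N]ltnW //.
    by rewrite mulrnAl mulrnAr mulrnAl mulrA.
  by rewrite subnn subSnn /psum big_ord_recl big_ord0 /hasse /= expr0 add0n binn
    addr0 mulr1 mul1r !mulr1n.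
have B : \sum_(k < n) (ev (hasse G k) u - psum (hasse G k) u (n - k)) * v ^+ k =
    psum (tshift G u) v n - psum G (u + v) n.
  by rewrite E -sumrB; apply: eq_bigr => k _; rewrite mulrBl.
have -> : ev G (u + v) - psum (tshift G u) v n = (ev G (u + v) - psum G (u + v) n) -
   \sum_(k < n) (ev (hasse G k) u - psum (hasse G k) u (n - k)) * v ^+ k.
  by rewrite B; ring.
apply: vgeB; first by apply: evP => //; apply: vgeD.
apply: vge_sum => k _; have -> : n%:R * e = (n - k)%:R * e + k%:R * e.
  by rewrite -mulrDl -natrD subnK // ltnW.
by apply: vgeM; [apply: evP|apply: vgeX].
Qed.

Lemma taylor_sub G u v : u 0 = 0 -> v 0 = 0 -> ev G u = ev (tshift G v) (u - v).
Proof.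
by move=> u0 v0; rewrite -taylor ?subrKC // lccB u0 v0 subrr.
Qed.

Lemma ev_continuous G u v b : 0 < b -> u 0 = 0 -> v 0 = 0 -> vge b (u - v) ->
  vge b (ev G u - ev G v).
Proof.
move=> b0 u0 v0 uv; rewrite (taylor_sub G u0 v0).
have := evP (tshift G v) 1 b0 uv.
by rewrite /psum big_ord1 mulr1 mul1r tshift0.
Qed.

(** The hypothesis expresses t^c G(t^rho x) = t^h H(x) coefficientwise. The factor t^c allows for
    derivatives: c = 0 serves for a germ and c = rho for its x-derivative. *)
Lemma psum_scale G H rho c h w n : 0 <= rho -> 0 <= c -> 0 <= h ->
  (forall i : nat, 't^c * 't^(i%:R * rho) * G i = 't^h * H i) ->
  't^c * psum G ('t^rho * w) n = 't^h * psum H w n.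
Proof.
move=> r0 c0 h0 hG; rewrite /psum !mulr_sumr; apply: eq_bigr => i _.
by rewrite exprMn tX // mulrA [in RHS]mulrA -hG; ring.
Qed.

Lemma ev_scale G H rho c h w : 0 <= rho -> 0 <= c -> 0 <= h ->
  (forall i : nat, 't^c * 't^(i%:R * rho) * G i = 't^h * H i) -> w 0 = 0 ->
  't^c * ev G ('t^rho * w) = 't^h * ev H w.
Proof.
move=> r0 c0 h0 hG /vge_pos0[e e0 we]; apply/eqP; rewrite -subr_eq0; apply/eqP.
apply: (vge_nat_eq0 e0) => n.
have -> : 't^c * ev G ('t^rho * w) - 't^h * ev H w =
    't^c * (ev G ('t^rho * w) - psum G ('t^rho * w) n) - 't^h * (ev H w - psum H
      w n).
  by rewrite !mulrBr (psum_scale _ _ r0 c0 h0 hG); ring.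
by apply: vgeB; apply: vgeMl; apply: evP => //; apply: vgeMl.
Qed.

(** Here w may have a constant term, so [ev H w] need not converge. The leading coefficient is read
    off a partial sum long enough to contain P and to push the tail beyond order h. *)
Lemma ev_scale_lead G H rho c h (P : {poly K}) w : 0 < rho -> 0 <= c -> 0 <= h ->
  (forall i : nat, 't^c * 't^(i%:R * rho) * G i = 't^h * H i) ->
  (forall i, P`_i = (H i) 0) ->
  vge h ('t^c * ev G ('t^rho * w)) /\ ('t^c * ev G ('t^rho * w)) h = P.[w 0].
Proof.
move=> r0 c0 h0 hG hP; have tw : vge rho ('t^rho * w) by apply/vge_t/ltW.
have [n0 hn0] := rat_archi h r0; pose n := maxn n0 (size P).
have hn : h < n%:R * rho.
  apply: lt_le_trans hn0 _; by apply: ler_natM; rewrite ?leq_maxl.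
have d := vgeMl 't^c (evP G n r0 tw).
have -> : 't^c * ev G ('t^rho * w) =
    't^c * (ev G ('t^rho * w) - psum G ('t^rho * w) n) + 't^h * psum H w n.
  by rewrite mulrBr (psum_scale _ _ (ltW r0) c0 h0 hG) subrK.
split; first by apply: vgeD (vge_t _ h0); apply: (vge_le d); apply: ltW.
rewrite lccD d // add0r lcc_t_at // lcc_sum (@horner_coef_wide _ n) ?leq_maxr //.
by apply: eq_bigr => i _; rewrite lccM_at0 lccX_at0 hP.
Qed.

(** In the Taylor expansion at v the linear coefficient has order at least e, and the higher terms
    have order at least 2 d, which is at least d + e. *)
Lemma ev_contraction e G u v d : 0 < e -> vge e (G 1%N) -> vge e u -> vge e v ->
  e <= d -> vge d (u - v) -> vge (d + e) (ev G u - ev G v).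
Proof.
move=> e0 G1 ue ve ed uv; have d0 : 0 < d := lt_le_trans e0 ed.
have v0 : v 0 = 0 := at0_vge e0 ve.
rewrite (taylor_sub G (at0_vge e0 ue) v0).
have := evP (tshift G v) 2 d0 uv;
  rewrite /psum !big_ord_recr big_ord0 /= add0r mulr1 tshift0.
rewrite expr1 opprD addrA => h.
rewrite -[X in vge _ X](subrK (tshift G v 1 * (u - v))); apply: vgeD.
  by apply: (vge_le h); lra.
rewrite addrC; apply: vgeM => //.
rewrite -(subrK (hasse G 1 0) (tshift G v 1)); apply: vgeD.
  have := evP (hasse G 1) 1 e0 ve.
  by rewrite /psum big_ord_recr big_ord0 /= add0r mulr1 mul1r.
by rewrite /hasse add0n binn.
Qed.

Lemma ev_vge_small e G w : 0 < e -> vge e (G 0%N) -> vge e w -> vge e (ev G w).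
Proof.
move=> e0 G0 we; rewrite -(subrK (G 0%N) (ev G w)); apply: vgeD => //.
have := evP G 1 e0 we.
by rewrite /psum big_ord_recr big_ord0 /= add0r mulr1 mul1r.
Qed.

Lemma ev_fixpoint G : G 0%N 0 = 0 -> G 1%N 0 = 0 ->
  exists2 w : lc, w 0 = 0 & w = ev G w.
Proof.
move=> /vge_pos0[e1 e10 hG01] /vge_pos0[e2 e20 hG12].
pose e := Num.min e1 e2; have e0 : 0 < e by rewrite lt_min e10.
have hG0 : vge e (G 0%N) by apply: (vge_le hG01); rewrite ge_min lexx.
have hG1 : vge e (G 1%N) by apply: (vge_le hG12); rewrite ge_min lexx orbT.
have [u [u0 uE]] : exists u : nat -> lc, u 0%N = 0 /\ forall n, u n.+1 = ev G (u n).
  by exists (fun n => iter n (ev G) 0).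
have ue n : vge e (u n) by elim: n => [|n IH]; rewrite ?u0 ?uE;
  [apply: vge0|apply: ev_vge_small].
have uS n : vge (n.+1%:R * e) (u n.+1 - u n).
  elim: n => [|n IH]; first by rewrite mul1r; apply: vgeB.
  rewrite [n.+2%:R]mulrSr mulrDl mul1r;
    have := @ev_contraction e G _ _ (n.+1%:R * e) e0 hG1 (ue n.+1) (ue n) _ IH.
  rewrite -!uE; apply.
  by have := @ler_natM 1 n.+1 e e0 isT; rewrite mul1r.
have [n|w hw] := lc_complete (u := u) e0.
  by apply: (vge_le (uS n)); exact: ler_natM.
have we : vge e w by rewrite -(subrK (u 1%N) w); apply: vgeD => //;
  have := hw 1%N; rewrite mul1r.
exists w; first exact: at0_vge we.
apply/eqP; rewrite -subr_eq0; apply/eqP; apply: (vge_nat_eq0 e0) => n.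
have -> : w - ev G w = (w - u n.+2) - (ev G w - ev G (u n.+1)).
  by rewrite (uE n.+1); ring.
apply: vgeB.
  exact: (vge_le (hw n.+2) (ler_natM e0 (leqW (leqnSn n)))).
have le1 : e <= n.+1%:R * e by have := @ler_natM 1 n.+1 e e0 isT; rewrite mul1r.
apply: (vge_le (ev_contraction e0 hG1 we (ue n.+1) le1 (hw n.+1))).
rewrite -addn1 natrD mulrDl; lra.
Qed.

(* Simplified Newton map w - ev G w / c, whose fixed points are the zeros of  *)
(* ev G.                                                                      *)
Definition newton G (c : K) : nat -> lc := fun i =>
  (if i == 1%N then 1 else 0) - lcmono c^-1 0 * G i.

Lemma ev_newton G (c : K) w : w 0 = 0 ->
  ev (newton G c) w = w - lcmono c^-1 0 * ev G w.
Proof.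
move=> w0; have [e e0 we] := vge_pos0 w0.
apply/esym/(@ev_unique e (e + e)) => // n.
have -> : psum (newton G c) w n = (if (1 < n)%N then w else 0) - lcmono c^-1 0 *
  psum G w n.
  rewrite /psum mulr_sumr; elim: n => [|n IH]; first by rewrite !big_ord0 subr0.
  rewrite !big_ord_recr /= IH /newton.
  case: n {IH} => [|[|n]] /=; rewrite ?expr1; ring.
case: ltnP => n1.
  have -> : w - lcmono c^-1 0 * ev G w - (w - lcmono c^-1 0 * psum G w n) =
    - (lcmono c^-1 0 * (ev G w - psum G w n)) by ring.
  by apply: vgeN; apply: vgeMl; apply: (vge_le (evP G n e0 we)); lra.
apply: vge_nneg; have := ler_natM e0 n1.
lra.
Qed.

Lemma newton_at0 G i : (G 1%N) 0 != 0 -> G 0%N 0 = 0 -> (i <= 1)%N ->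
  newton G ((G 1%N) 0) i 0 = 0.
Proof.
move=> G1 G0; rewrite /newton lccB lccM_at0; case: i => [|[|//]] _.
  by rewrite G0 mulr0 subr0 lcc0.
by rewrite lcc1 /= mulVf // subrr.
Qed.

(** Hensel's lemma: with c the unit [G 1 0], the simplified Newton map has a linear coefficient
    vanishing at 0, hence is a contraction. *)
Lemma implicit_root G : G 0%N 0 = 0 -> (G 1%N) 0 != 0 ->
  exists2 w : lc, w 0 = 0 & ev G w = 0.
Proof.
move=> G0 G1; have [||w w0 hw] := @ev_fixpoint (newton G ((G 1%N) 0)).
- exact: newton_at0.
- exact: newton_at0.
exists w => //; move: hw; rewrite ev_newton //.
set x := _ * _ => hw; have x0 : x = 0 by rewrite -(subKr w x) -hw subrr.
apply: lcseries_eq => q; have := congr1 (fun s : lc => s q) x0.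
rewrite lcc0 lcc_mono // subr0 => /eqP; rewrite mulf_eq0 invr_eq0 (negbTE G1) /=.
by move/eqP.
Qed.

End Evaluation.
Arguments evP {K e} G {w} n _ _.

(** * The Newton-Puiseux theorem *)

Section NewtonPuiseux.
Variable K : numClosedFieldType.
Local Notation lc := (lcseries K).
Implicit Types (s t u v w : lc) (G H : nat -> lc) (b c d e h rho : rat).
Implicit Types (P : {poly K}) (z : K) (k i : nat).

(** Solvability for equations regular of order k in x, isolated as a predicate so that [newton_step]
    can take the induction hypothesis of [newton_puiseux] as an argument. *)
Definition has_root_of_order k := forall G, (forall i, (i < k)%N -> G i 0 = 0) ->
  G k 0 != 0 -> exists2 w : lc, w 0 = 0 & ev G w = 0.

(** After the substitution x = t^rho (z + w), the i-th coefficient divided by t^h takes at 0 the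
    value of the i-th Hasse derivative of P at z. The new equation is thus regular of order k, the
    multiplicity of z. *)
Lemma newton_step G H c h rho P z k : 0 < rho -> 0 <= c -> 0 <= h ->
  (forall i : nat, 't^c * 't^(i%:R * rho) * G i = 't^h * H i) ->
  (forall i, P`_i = H i 0) ->
  (forall i, (i < k)%N -> (P^`N(i)).[z] = 0) -> (P^`N(k)).[z] != 0 ->
  has_root_of_order k ->
  exists2 w : lc, w 0 = z & ev G ('t^rho * w) = 0.
Proof.
move=> r0 c0 h0 hG hP Pz0 Pzk np; pose u : lc := lcmono z 0.
have r0' : 0 <= rho := ltW r0.
have u0 : u 0 = z by [].
have hH i : exists Hi : lc,
    't^c * 't^(i%:R * rho) * tshift G ('t^rho * u) i = 't^h * Hi /\ Hi 0 =
      (P^`N(i)).[z].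
  have ir : 0 <= i%:R * rho by rewrite mulr_ge0.
  have ci : 0 <= c + i%:R * rho by rewrite addr_ge0.
  have hGi (l : nat) : 't^(c + i%:R * rho) * 't^(l%:R * rho) * hasse G i l = 't^h
    * hasse H i l.
    rewrite /hasse !mulrnAr -hG natrD mulrDl !tD ?mulr_ge0 //.
    by congr (_ *+ _); ring.
  have hPi l : (P^`N(i))`_l = hasse H i l 0.
    by rewrite coef_nderivn lccMn hP addnC.
  have [] := ev_scale_lead u r0 ci h0 hGi hPi.
  rewrite u0 => /(vge_divt h0)[Hi HiE]; rewrite HiE lcc_t_at // => Hi0.
  by exists Hi; split => //; rewrite -HiE tD // /tshift; ring.
have {hH}[H2 hH2] := choice hH.
have [||w w0 hw] := np H2.
- by move=> i ik; rewrite (hH2 i).2 Pz0.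
- by rewrite (hH2 k).2.
exists (u + w); first by rewrite lccD u0 w0 addr0.
apply: (tI c0); rewrite mulr0 mulrDr taylor.
- by rewrite (@ev_scale _ _ H2 rho c h) ?hw ?mulr0 // => i; apply: (hH2 i).1.
- exact: (vge_t u r0' r0).
- exact: (vge_t w r0' r0).
Qed.

(** The slope is the minimum of ord(G i) / (k - i) over i < k: the edge of the Newton polygon ending
    at the vertex of x^k. *)
Lemma newton_slope G k : (forall i, (i < k)%N -> G i 0 = 0) ->
  (exists2 i, (i < k)%N & G i != 0) ->
  exists rho, [/\ 0 < rho,
    exists2 i, (i < k)%N & G i (k%:R * rho - i%:R * rho) != 0 &
    forall i, (i < k)%N -> vge (k%:R * rho - i%:R * rho) (G i)].
Proof.
move=> G0 [i0 i0k Gi0].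
have hd i : exists d : rat, G i != 0 -> [/\ 0 <= d, G i d != 0 & vge d (G i)].
  have [->|/order_exists[d hd]] := eqVneq (G i) 0; first by exists 0.
  by exists d.
have {hd}[d hd] := choice hd.
have kpos (i : 'I_k) : 0 < (k - i)%:R :> rat by rewrite ltr0n subn_gt0.
have kB (i : 'I_k) rho : k%:R * rho - i%:R * rho = (k - i)%:R * rho.
  by rewrite -mulrBl natrB // ltnW.
have [i /= Gi imin] := @Order.TotalTheory.arg_minP _ _ _ (Ordinal i0k)
  (fun i : 'I_k => G i != 0) (fun i : 'I_k => d i / (k - i)%:R) Gi0.
have [oi0 Goi _] := hd i Gi.
exists (d i / (k - i)%:R); split.
- rewrite divr_gt0 // lt_neqAle oi0 andbT; apply: contraNneq Goi => <-.
  by rewrite G0.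
- by exists i => //; rewrite kB mulrC divfK // gt_eqF.
move=> j jk; rewrite (kB (Ordinal jk)) /=.
have [->|Gj] := eqVneq (G j) 0; first exact: vge0.
have [_ _ hj] := hd j Gj; apply: (vge_le hj).
by have := imin (Ordinal jk) Gj; rewrite ler_pdivlMr // mulrC.
Qed.

Lemma newton_puiseux k : (0 < k)%N -> has_root_of_order k.
Proof.
have [n] := ubnP k; elim: n k => // n IH k kn k0 G G0 Gk.
(* Tschirnhaus shift: recentring at a root of the (k-1)-st derivative makes the coefficient of
   x^(k-1) vanish. *)
have [phi phi0 hphi] : exists2 w : lc, w 0 = 0 & ev (hasse G k.-1) w = 0.
  apply: implicit_root; first by rewrite /hasse add0n binn G0 // prednK.
  by rewrite /hasse add1n prednK // lccMn mulrn_eq0 negb_or -lt0n bin_gt0 leq_pred.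
pose G1 := tshift G phi.
have G1E i : G1 i 0 = G i 0 by rewrite /G1 /tshift ev_at0 // /hasse add0n binn.
have [[i ik G1i]|noG1] := pselect (exists2 i, (i < k)%N & G1 i != 0); last first.
  exists phi => //; rewrite -tshift0; apply/eqP; apply: contra_notT noG1 => h.
  by exists 0%N.
have [||rho [r0 [j jk hj] hr]] := @newton_slope G1 k.
- by move=> l lk; rewrite G1E G0.
- by exists i.
have kr : 0 <= k%:R * rho by rewrite mulr_ge0 // ltW.
have hH l : exists Hl : lc, 't^(l%:R * rho) * G1 l = 't^(k%:R * rho) * Hl.
  have lr : 0 <= l%:R * rho by rewrite mulr_ge0 // ltW.
  apply: vge_divt => //; case: (ltnP l k) => [lk|kl].
    have := vgeM (@vge_mono K 1 (l%:R * rho)) (hr _ lk).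
    by rewrite addrC subrK.
  by apply: (vge_le (vge_t _ lr)); apply: ler_natM.
have {hH}[H hH] := choice hH.
have H0 l : H l 0 = G1 l (k%:R * rho - l%:R * rho).
  by rewrite -(lcc_t_at _ kr) -hH lcc_t // mulr_ge0 // ltW.
pose P := \poly_(l < k.+1) (H l 0).
have hP l : P`_l = H l 0.
  rewrite coef_poly; case: ltnP => // kl; rewrite H0 lcc_lt0 //.
  by rewrite subr_lt0 ltr_pM2r // ltr_nat.
have Pk : P`_k != 0 by rewrite hP H0 subrr G1E.
have Pj : P`_j != 0 by rewrite hP H0.
have Pk1 : P`_k.-1 = 0.
  by rewrite hP H0 /G1 /tshift hphi lcc0.
have sP : size P = k.+1.
  by apply/anti_leq; rewrite size_poly /= ltnNge; apply: contra Pk => /leq_sizeP ->.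
have [z Pz] : exists z, root P z by apply/closed_rootP; rewrite sP eqSS -lt0n.
(* P has degree k, no term of degree k - 1, and another nonzero coefficient j < k, so it is not a
   k-th power of X - z up to a scalar. At z = 0 the coefficient j shows this; otherwise the (k-1)-st
   Hasse derivative k P_k X does. *)
have [l lk Pl] : exists2 l, (l < k)%N & (P^`N(l)).[z] != 0.
  have [z0|z0] := eqVneq z 0.
    exists j => //; rewrite z0 horner_coef0 coef_nderivn addn0 binn.
    by rewrite mulr1n.
  exists k.-1; first by rewrite prednK.
  rewrite (@horner_coef_wide _ 2).
    rewrite !big_ord_recr big_ord0 /= !coef_nderivn addn0 Pk1 mul0rn mul0r !add0r.
    rewrite addn1 prednK // expr1 mulf_neq0 // mulrn_eq0 negb_or Pk andbT -lt0n.
    by rewrite bin_gt0 leq_pred.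
  apply/leq_sizeP => l l2; rewrite coef_nderivn nth_default ?mul0rn // sP.
  by rewrite -(prednK k0) -addn2 leq_add2l.
have [k' Pk' k'min] := ex_minnP (ex_intro (fun l => (P^`N(l)).[z] != 0) l Pl).
have k'k : (k' < k)%N := leq_ltn_trans (k'min _ Pl) lk.
have k'0 : (0 < k')%N.
  rewrite lt0n; apply: contraNneq Pk' => ->.
  by rewrite nderivn0; apply/eqP/rootP.
have [|||w _ hw] := @newton_step G1 H 0 (k%:R * rho) rho P z k' r0 (lexx _) kr _
  hP _ Pk'.
- by move=> i'; rewrite t0 mul1r.
- by move=> i'; apply: contraTeq => /k'min; rewrite leqNgt.
- by apply: IH => //; apply: leq_trans k'k _.
exists (phi + 't^rho * w); last by rewrite taylor // (vge_t w (ltW r0) r0).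
by rewrite lccD phi0 (vge_t w (ltW r0) r0) addr0.
Qed.

(* The Newton polygon edge of slope rho: the initial form of                  *)
(* sum_i G_i t^(i rho) w^i is t^h P(w).                                       *)
Lemma initial_form G rho : 0 < rho -> (exists i, G i != 0) ->
  exists h H P, [/\ 0 <= h, P != 0,
    forall i : nat, 't^(i%:R * rho) * G i = 't^h * H i &
    forall i, P`_i = H i 0].
Proof.
move=> r0 [i0 Gi0].
have rn i : 0 <= i%:R * rho by rewrite mulr_ge0 // ltW.
have hd i : exists d : rat, G i != 0 -> [/\ 0 <= d, G i d != 0 & vge d (G i)].
  have [->|/order_exists[d hd]] := eqVneq (G i) 0; first by exists 0.
  by exists d.
have {hd}[d hd] := choice hd.
(* For i >= M already i rho exceeds the value attained at i0, so the minimum over i < M is the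
   global one. *)
have [M hM] := rat_archi (d i0 + i0%:R * rho) r0.
have i0M : (i0 < M)%N.
  have [oi _ _] := hd _ Gi0; rewrite -(ltr_nat rat) -(ltr_pM2r r0); lra.
have [i /= Gi imin] := @Order.TotalTheory.arg_minP _ _ _ (Ordinal i0M)
  (fun i : 'I_M => G i != 0) (fun i : 'I_M => d i + i%:R * rho) Gi0.
set h := d i + i%:R * rho in imin.
have [oi Goi _] := hd _ Gi.
have h0 : 0 <= h by rewrite addr_ge0.
have hM' : h < M%:R * rho := le_lt_trans (imin (Ordinal i0M) Gi0) hM.
have hv l : vge h ('t^(l%:R * rho) * G l).
  have [->|Gl] := eqVneq (G l) 0; first by rewrite mulr0; apply: vge0.
  case: (ltnP l M) => [lM|Ml]; last first.
    apply: (vge_le (vge_t _ (rn l))); apply: ltW; apply: lt_le_trans hM' _.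
    exact: ler_natM.
  have [_ _ hl] := hd _ Gl.
  apply: (vge_le (vgeM (@vge_mono K 1 (l%:R * rho)) hl)).
  by rewrite addrC; apply: (imin (Ordinal lM) Gl).
have {hv}[H hH] := choice (fun l => vge_divt h0 (hv l)).
have H0 l : H l 0 = G l (h - l%:R * rho).
  by rewrite -(lcc_t_at _ h0) -hH lcc_t.
pose P := \poly_(l < M) (H l 0).
have hP l : P`_l = H l 0.
  rewrite coef_poly; case: ltnP => // Ml; rewrite H0 lcc_lt0 //.
  by rewrite subr_lt0; apply: lt_le_trans hM' _; apply: ler_natM.
exists h, H, P; split => //.
apply: contraNneq Goi => P0; have := hP i; rewrite P0 coef0 H0 /h addrK.
by move=> <-.
Qed.

Lemma newton_step_root G H c h rho P z : 0 < rho -> 0 <= c -> 0 <= h ->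
  (forall i : nat, 't^c * 't^(i%:R * rho) * G i = 't^h * H i) ->
  (forall i, P`_i = H i 0) -> P != 0 -> root P z ->
  exists2 w : lc, w 0 = z & ev G ('t^rho * w) = 0.
Proof.
move=> r0 c0 h0 hG hP P0 Pz.
have [l Pl] : exists l, (P^`N(l)).[z] != 0.
  exists (size P).-1; rewrite (@horner_coef_wide _ 1).
    by rewrite big_ord1 coef_nderivn addn0 binn mulr1 mulr1n lead_coef_eq0.
  apply/leq_sizeP => l l1; rewrite coef_nderivn nth_default ?mul0rn //.
  by apply: leq_trans (leqSpred _) _; rewrite -addn1 leq_add2l.
have [k Pk kmin] := ex_minnP (ex_intro (fun l => (P^`N(l)).[z] != 0) l Pl).
have k0 : (0 < k)%N.
  by rewrite lt0n; apply: contraNneq Pk => ->; rewrite nderivn0; apply/eqP/rootP.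
apply: (newton_step r0 c0 h0 hG hP _ Pk (newton_puiseux k0)) => i.
by apply: contraTeq => /kmin; rewrite leqNgt.
Qed.

End NewtonPuiseux.

(** * Convergence of formal roots *)

Local Notation normc := (@ComplexField.Normc.normc _).

(** * Weighted absolute sums of coefficients *)

Section Norm.
Variable R : realType.
Local Notation K := R[i].
Local Notation lc := (lcseries K).
Implicit Types (s t u v w : lc) (G H : nat -> lc) (b c d e h p q : rat).
Implicit Types (rho C D E : R) (z : K) (k i n : nat).

Lemma normcD (x y : K) : normc (x + y) <= normc x + normc y.
Proof. exact: (@le_normcD R x y). Qed.

Lemma normc_ge0 (x : K) : 0 <= normc x :> R.
Proof. by case: x => a b; apply: sqrtr_ge0. Qed.

Lemma normc_mulrn (x : K) n : normc (x *+ n) = normc x *+ n :> R.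
Proof. exact: (@normcMn R x n). Qed.

Lemma normc_sum (I : Type) (r : seq I) (F : I -> K) :
  normc (\sum_(i <- r) F i) <= \sum_(i <- r) normc (F i) :> R.
Proof.
elim: r => [|x r IH]; first by rewrite !big_nil ComplexField.Normc.normc0.
by rewrite !big_cons (le_trans (normcD _ _)) // lerD2l.
Qed.

Definition ratpow rho q : R := rho `^ (ratr q).

Lemma ratpow_gt0 rho q : 0 < rho -> 0 < ratpow rho q.
Proof. exact: powR_gt0. Qed.

Lemma ratpowD rho p q : 0 < rho -> ratpow rho (p + q) = ratpow rho p * ratpow rho q.
Proof. by move=> r0; rewrite /ratpow rmorphD powRD // (gt_eqF r0) /= implybT. Qed.

Lemma ratpow0 rho : ratpow rho 0 = 1.
Proof. by rewrite /ratpow rmorph0 powRr0. Qed.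

Lemma ratpow_le1 rho q : 0 < rho <= 1 -> 0 <= q -> ratpow rho q <= 1.
Proof.
move=> r01 q0; rewrite -(ratpow0 rho); apply: ger_powR => //.
by rewrite ler_rat.
Qed.

(* The norm sum_q |s_q| rho^q is at most C. *)
Definition norm_le rho s C := forall r : seq rat, uniq r ->
  \sum_(q <- r) normc (s q) * ratpow rho q <= C.

Lemma norm_le_ge0 rho s C : norm_le rho s C -> 0 <= C.
Proof. by move=> /(_ [::] isT); rewrite big_nil. Qed.

Lemma norm_le_le rho s C D : norm_le rho s C -> C <= D -> norm_le rho s D.
Proof. by move=> h CD r ur; apply: le_trans (h r ur) CD. Qed.

Lemma norm_le_dom rho s t C : 0 < rho -> norm_le rho t C ->
  (forall q, normc (s q) <= normc (t q) :> R) -> norm_le rho s C.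
Proof.
move=> r0 h st r ur; apply: le_trans (h r ur); apply: ler_sum => q _.
by rewrite ler_wpM2r // ltW // ratpow_gt0.
Qed.

Lemma norm_le0 rho C : 0 <= C -> norm_le rho 0 C.
Proof.
move=> C0 r _; rewrite big1 // => q _.
by rewrite lcc0 ComplexField.Normc.normc0 mul0r.
Qed.

Lemma norm_leD rho s t C D : 0 < rho -> norm_le rho s C -> norm_le rho t D ->
  norm_le rho (s + t) (C + D).
Proof.
move=> r0 hs ht r ur; apply: le_trans (lerD (hs r ur) (ht r ur)).
rewrite -big_split; apply: ler_sum => q _ /=; rewrite -mulrDl.
by rewrite ler_wpM2r ?normcD // ltW // ratpow_gt0.
Qed.

Lemma norm_leMn rho s C n : 0 < rho -> norm_le rho s C ->
  norm_le rho (s *+ n) (C *+ n).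
Proof.
move=> r0 hs r ur; rewrite (eq_bigr (fun q => (normc (s q) * ratpow rho q) *+ n)).
  by rewrite sumrMnl lerMn2r hs // orbT.
by move=> q _; rewrite lccMn normc_mulrn mulrnAl.
Qed.

Lemma seq_ub (r : seq rat) : exists b, forall q, q \in r -> q <= b.
Proof.
elim: r => [|x r [b hb]]; first by exists 0.
exists (Num.max x b) => q; rewrite inE => /orP[/eqP ->|/hb qb].
  by rewrite le_max lexx.
by rewrite le_max qb orbT.
Qed.

Lemma norm_leM rho s t C D : 0 < rho -> norm_le rho s C -> norm_le rho t D ->
  norm_le rho (s * t) (C * D).
Proof.
move=> r0 hs ht r ur; have [b hb] := seq_ub r.
have [rs us hrs] := left_finite_le b (lcseriesP s).
have pw q : 0 <= ratpow rho q by rewrite ltW // ratpow_gt0.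
have D0 := norm_le_ge0 ht.
apply: (@le_trans _ _ (\sum_(q <- r) \sum_(p <- rs)
    (normc (s p) * ratpow rho p) * (normc (t (q - p)) * ratpow rho (q - p)))).
  rewrite big_seq [leRHS]big_seq; apply: ler_sum => q qr.
  rewrite lccM (@conv_seq _ rs) //; last first.
    move=> p sp tp; apply: hrs => //; have := left_finite_ge0 (lcseriesP t) tp.
    by rewrite subr_ge0 => pq; apply: le_trans pq (hb _ qr).
  apply: (@le_trans _ _ ((\sum_(p <- rs) normc (s p * t (q - p))) * ratpow rho q)).
    by rewrite ler_wpM2r // normc_sum.
  rewrite mulr_suml; apply: ler_sum => p _; rewrite ComplexField.Normc.normcM.
  have -> : ratpow rho q = ratpow rho (q - p) * ratpow rho p by rewrite -ratpowD
    // subrK.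
  by rewrite le_eqVlt; apply/orP; left; apply/eqP; ring.
rewrite exchange_big /=; apply: (@le_trans _ _ (\sum_(p <- rs) (normc (s p) *
  ratpow rho p) * D)).
  apply: ler_sum => p _; rewrite -mulr_sumr ler_wpM2l ?mulr_ge0 ?normc_ge0 //.
  have := ht [seq q - p | q <- r]; rewrite big_map; apply.
  by rewrite map_inj_uniq // => x y /addIr.
by rewrite -mulr_suml ler_wpM2r // hs.
Qed.

Lemma norm_le_mono rho z h : norm_le rho (lcmono z h) (normc z * ratpow rho h).
Proof.
move=> r ur; have [hr|hr] := boolP (h \in r); last first.
  rewrite big_seq big1 => [|q qr]; first by rewrite mulr_ge0 ?normc_ge0 ?powR_ge0.
  rewrite /= ifF ?ComplexField.Normc.normc0 ?mul0r //.
  by apply: contraNF hr => /andP[/eqP <-].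
rewrite (bigD1_seq h) //= big1 => [|q /negbTE qh].
  rewrite addr0 eqxx /=; case: ifP => // _.
  by rewrite ComplexField.Normc.normc0 mul0r mulr_ge0 ?normc_ge0 ?powR_ge0.
by rewrite qh ComplexField.Normc.normc0 mul0r.
Qed.

Lemma norm_le1 rho : norm_le rho 1 1.
Proof. by have := norm_le_mono rho 1 0;
  rewrite ratpow0 mulr1 ComplexField.Normc.normc1. Qed.

Lemma norm_leX rho s C n : 0 < rho -> norm_le rho s C ->
  norm_le rho (s ^+ n) (C ^+ n).
Proof.
move=> r0 hs; elim: n => [|n IH]; first exact: norm_le1.
by rewrite !exprS; apply: norm_leM.
Qed.

Lemma norm_le_divt rho s h C : 0 < rho -> 0 <= h -> norm_le rho ('t^h * s) C ->
  norm_le rho s (ratpow rho (- h) * C).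
Proof.
move=> r0 h0 hs r ur; have := hs [seq q + h | q <- r].
rewrite map_inj_uniq ?ur => [/(_ isT)|x y /addIr //].
rewrite big_map => /(ler_wpM2l (ltW (ratpow_gt0 (- h) r0))); apply: le_trans.
rewrite mulr_sumr; apply: ler_sum => q _.
have hN : ratpow rho (- h) * ratpow rho h = 1 by rewrite -ratpowD // addNr ratpow0.
by rewrite lcc_t // addrK ratpowD // -[leLHS]mul1r -hN le_eqVlt; apply/orP; left;
  apply/eqP; ring.
Qed.

Lemma norm_le_sum rho n (F : nat -> lc) (C : nat -> R) : 0 < rho ->
  (forall i, norm_le rho (F i) (C i)) ->
  norm_le rho (\sum_(i < n) F i) (\sum_(i < n) C i).
Proof.
move=> r0 hF; elim: n => [|n IH]; first by rewrite !big_ord0; apply: norm_le0.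
by rewrite !big_ord_recr; apply: norm_leD.
Qed.

Lemma norm_le_trunc rho s C b : 0 < rho -> norm_le rho s C ->
  norm_le rho (lctrunc b s) C.
Proof.
move=> r0 hs; apply: norm_le_dom r0 hs _ => q /=.
by case: ifP => // _; rewrite ComplexField.Normc.normc0 normc_ge0.
Qed.

(** Each inequality in [norm_le] involves finitely many coefficients, so the bound passes to
    limits. *)
Lemma norm_le_local rho s C :
  (forall b, exists t, norm_le rho t C /\ vge b (s - t)) -> norm_le rho s C.
Proof.
move=> hs r ur; have [b hb] := seq_ub r; have [t [ht st]] := hs (b + 1).
have := ht r ur; rewrite !(big_seq _ _ _ (fun q => normc _ * _)).
congr (_ <= _); apply: eq_bigr => q qr; congr (normc _ * _).
apply/eqP; rewrite eq_sym -subr_eq0 -lccB st //.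
by apply: le_lt_trans (hb _ qr) _; rewrite ltrDl.
Qed.

Lemma norm_le_ev rho G w C : 0 < rho -> w 0 = 0 ->
  (forall n, norm_le rho (psum G w n) C) ->
  norm_le rho (ev G w) C.
Proof.
move=> r0 /vge_pos0[e e0 we] h; apply: norm_le_local => b.
have [n hn] := rat_archi b e0; exists (psum G w n); split=> //.
by apply: (vge_le (evP G n e0 we)); apply: ltW.
Qed.

Lemma geometric_sum (a : nat -> R) C n : (forall i, a i <= C * 2^-1 ^+ i) ->
  0 <= C ->
  \sum_(i < n) a i <= 2 * C.
Proof.
move=> ha C0; apply: (@le_trans _ _ (2 * C - 2 * C * 2^-1 ^+ n)); last first.
  by rewrite gerBl !mulr_ge0 // exprn_ge0 // invr_ge0.
elim: n => [|n IH]; first by rewrite big_ord0 expr0; lra.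
rewrite big_ord_recr /=; have := ha n; rewrite exprS; lra.
Qed.

Lemma norm_le_ev_geometric rho G w C : 0 < rho -> 0 <= C -> w 0 = 0 ->
  (forall i, norm_le rho (G i * w ^+ i) (C * 2^-1 ^+ i)) ->
  norm_le rho (ev G w) (2 * C).
Proof.
move=> r0 C0 w0 hG; apply: norm_le_ev => // n.
apply: (norm_le_le (norm_le_sum n r0 hG)).
exact: (@geometric_sum (fun i => C * 2^-1 ^+ i)).
Qed.

Lemma norm_le_radius rho1 rho s C : 0 < rho -> rho <= rho1 -> norm_le rho1 s C ->
  norm_le rho s C.
Proof.
move=> r0 r1 hs r ur; apply: le_trans (hs r ur); apply: ler_sum => q _.
have [->|sq] := eqVneq (s q) 0; first by rewrite ComplexField.Normc.normc0 !mul0r.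
rewrite ler_wpM2l ?normc_ge0 //; apply: ge0_ler_powR => //.
- by rewrite ler0q; apply: left_finite_ge0 (lcseriesP s) sq.
- by rewrite nnegrE ltW.
- by rewrite nnegrE ltW // (lt_le_trans r0).
Qed.

(** A series of order at least e > 0 shrinks by the factor y^e when the radius is multiplied by y <=
    1; y is chosen with y^e = min(1, E / (C + 1)). *)
Lemma norm_le_small rho1 s C E : 0 < rho1 -> s 0 = 0 -> norm_le rho1 s C -> 0 < E ->
  exists2 rho2, 0 < rho2 <= rho1 & forall rho, 0 < rho <= rho2 -> norm_le rho s E.
Proof.
move=> r10 /vge_pos0[e e0 se] hs E0; have C0 := norm_le_ge0 hs.
have re0 : 0 < ratr e :> R by rewrite ltr0q.
pose x : R := Num.min 1 (E / (C + 1)).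
have x0 : 0 < x by rewrite lt_min ltr01 divr_gt0 // ltr_wpDl.
have xC : x * C <= E.
  apply: (@le_trans _ _ (E / (C + 1) * C)).
    by rewrite ler_wpM2r // ge_min lexx orbT.
  by rewrite mulrAC ler_pdivrMr ?ltr_wpDl // mulrDr mulr1 lerDl ltW.
pose y : R := x `^ (ratr e)^-1.
have y0 : 0 < y by apply: powR_gt0.
have y1 : y <= 1.
  have : 0 < x <= 1 by rewrite x0 ge_min lexx.
  move=> /ger_powR h; rewrite -(powRr0 x); apply: h.
  by rewrite invr_ge0 ltW.
have ye : ratpow y e = x by rewrite /ratpow /y -powRrM mulVf ?gt_eqF // powRr1 //
  ltW.
exists (y * rho1); first by rewrite mulr_gt0 //= ler_piMl // ltW.
move=> rho /andP[r0 rr]; apply: (norm_le_radius r0 rr) => {rho r0 rr} r ur.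
apply: le_trans (le_trans _ xC) _ => //.
apply: le_trans (ler_wpM2l (ltW x0) (hs r ur)).
rewrite mulr_sumr; apply: ler_sum => q _.
have [qe|qe] := ltP q e; first by rewrite se // ComplexField.Normc.normc0 !mul0r
  mulr0.
rewrite mulrCA ler_wpM2l ?normc_ge0 // /ratpow powRM ?(ltW y0) ?(ltW r10) //.
rewrite ler_wpM2r ?powR_ge0 // -ye; apply: ger_powR; first by rewrite y0.
by rewrite ler_rat.
Qed.

End Norm.

(** * Common denominators of exponents *)

Section Denominators.
Variable K : fieldType.
Local Notation lc := (lcseries K).
Implicit Types (s t u v w : lc) (G H : nat -> lc) (b c d e h p q : rat).
Implicit Types (k i n N : nat).

Definition den N s := forall q, s q != 0 -> q * N%:R \is a Num.int.

Lemma denD N s t : den N s -> den N t -> den N (s + t).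
Proof.
move=> hs ht q; rewrite lccD.
by have [->|/hs //] := eqVneq (s q) 0; rewrite add0r; apply: ht.
Qed.

Lemma denN N s : den N s -> den N (- s).
Proof. by move=> hs q; rewrite lccN oppr_eq0; apply: hs. Qed.

Lemma den0 N : den N 0.
Proof. by move=> q; rewrite lcc0 eqxx. Qed.

Lemma denMn N s n : den N s -> den N (s *+ n).
Proof.
by move=> hs; elim: n => [|n IH]; [apply: den0|rewrite mulrS; apply: denD].
Qed.

Lemma denM N s t : den N s -> den N t -> den N (s * t).
Proof.
move=> hs ht q st; apply: contraNT st => qN; apply/eqP.
rewrite lccM (@conv_seq _ [::]) ?big_nil // => p /hs hp /ht hq.
by case/negP: qN; rewrite -(subrK p q) mulrDl; apply: rpredD.
Qed.

Lemma den_mono N (z : K) h : h * N%:R \is a Num.int -> den N (lcmono z h).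
Proof. by move=> hN q /=; case: (eqVneq q h) => [->|]; rewrite ?eqxx. Qed.

Lemma denX N s n : den N s -> den N (s ^+ n).
Proof.
move=> hs; elim: n => [|n IH]; first by apply: den_mono; rewrite mul0r.
by rewrite exprS; apply: denM.
Qed.

Lemma den_sum N n (F : nat -> lc) : (forall i, den N (F i)) ->
  den N (\sum_(i < n) F i).
Proof.
move=> hF; elim: n => [|n IH]; first by rewrite big_ord0; apply: den0.
by rewrite big_ord_recr; apply: denD.
Qed.

Lemma den_local N s : (forall b, exists t, den N t /\ vge b (s - t)) -> den N s.
Proof.
move=> hs q sq; have [t [ht st]] := hs (q + 1); apply: ht.
have := st q; rewrite ltrDl lccB => /(_ isT)/eqP.
by rewrite subr_eq0 => /eqP <-.
Qed.

Lemma den_ev N G w : w 0 = 0 -> (forall i, den N (G i)) -> den N w ->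
  den N (ev G w).
Proof.
move=> /vge_pos0[e e0 we] hG hw; apply: den_local => b.
have [n hn] := rat_archi b e0; exists (psum G w n); split.
  by apply: (@den_sum N n (fun i => G i * w ^+ i)) => i; apply: denM;
    last apply: denX.
by apply: (vge_le (evP G n e0 we)); apply: ltW.
Qed.

Lemma den_tshift N G w k : w 0 = 0 -> (forall i, den N (G i)) -> den N w ->
  den N (tshift G w k).
Proof. by move=> w0 hG hw; apply: den_ev => // i; apply: denMn. Qed.

Lemma den_trunc N s b : den N s -> den N (lctrunc b s).
Proof. by move=> hs q /=; case: ifP => _; [apply: hs|rewrite eqxx]. Qed.

Lemma den_divt N s h : 0 <= h -> h * N%:R \is a Num.int -> den N ('t^h * s) ->
  den N s.
Proof.
move=> h0 hN hs q sq; rewrite -(addrK h q) mulrBl rpredB // hs //.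
by rewrite lcc_t // addrK.
Qed.

Lemma den_dvd N M s : den N s -> den (N * M) s.
Proof. by move=> hs q /hs hq; rewrite natrM mulrA rpredM // rpred_nat. Qed.

Lemma common_denominator (r : seq rat) : exists2 N : nat, (0 < N)%N &
  forall q, q \in r -> q * N%:R \is a Num.int.
Proof.
elim: r => [|x r [N N0 hN]]; first by exists 1%N.
exists (`|denq x| * N)%N; first by rewrite muln_gt0 N0 absz_gt0 denq_neq0.
move=> q; rewrite inE natrM => /orP[/eqP ->|/hN qN]; last first.
  by rewrite mulrCA rpredM // rpred_nat.
rewrite mulrA rpredM ?rpred_nat //.
have -> : `|denq x|%N%:R = (denq x)%:~R :> rat.
  by rewrite -[in RHS](gtz0_abs (denq_gt0 x)).
by rewrite -numqE intr_int.
Qed.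

(* The truncations of a fixed point w = ev G w are obtained from 0 by         *)
(* repeatedly applying ev G and truncating.                                   *)
Lemma fixpoint_ind (S : lc -> Prop) G w : w 0 = 0 -> w = ev G w -> G 1%N 0 = 0 ->
  S 0 ->
  (forall v b, v 0 = 0 -> S v -> S (lctrunc b (ev G v))) ->
  forall b, S (lctrunc b w).
Proof.
move=> w0 hw G10 S0 SG b.
have [e1 e10 we1] := vge_pos0 w0; have [e2 e20 Ge2] := vge_pos0 G10.
pose e := Num.min e1 e2; have e0 : 0 < e by rewrite lt_min e10.
have we : vge e w by apply: (vge_le we1); rewrite ge_min lexx.
have Ge : vge e (G 1%N) by apply: (vge_le Ge2); rewrite ge_min lexx orbT.
have te b' : vge e (lctrunc b' w).
  by move=> p pe /=; rewrite we // if_same.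
(* Each application of [ev G] gains e in accuracy, so the truncation at n e determines that at (n +
   1) e. *)
have step n b' : (0 < n)%N -> b' <= n.+1%:R * e ->
    lctrunc b' w = lctrunc b' (ev G (lctrunc (n%:R * e) w)).
  move=> n0 hb; apply: trunc_eq; rewrite [X in X - _]hw.
  have ne : e <= n%:R * e by have := @ler_natM 1 n e e0 n0; rewrite mul1r.
  apply: (vge_le (ev_contraction e0 Ge we (te _) ne (@vge_trunc _ _ _))).
  by apply: le_trans hb _; rewrite mulrSr mulrDl mul1r.
have Sn n : S (lctrunc (n.+1%:R * e) w).
  elim: n => [|n IH]; last by rewrite (step n.+1) //; apply: SG => //;
    apply: (te _ _ e0).
  rewrite mul1r (_ : lctrunc _ _ = 0) //; apply: lcseries_eq => q /=.
  by rewrite if_same; case: ifP => // /we.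
have [n hn] := rat_archi b e0.
rewrite (step n.+1 b) //; first by apply: SG (Sn n); apply: (te _ _ e0).
apply: le_trans (ltW hn) _; apply: ler_natM => //.
exact: leqW (leqnSn n).
Qed.

End Denominators.

(** * Cauchy-type estimates and Taylor shifts *)

Section Convergence.
Variable R : realType.
Local Notation K := R[i].
Local Notation lc := (lcseries K).
Implicit Types (s t u v w : lc) (G H : nat -> lc) (b c d e h p q : rat).
Implicit Types (rho C D E : R) (z : K) (k i n : nat).

Definition geom_le rho G C E := forall i, norm_le rho (G i) (C * E ^+ i).

Lemma leq_bin_expn n k : ('C(n, k) <= 2 ^ n)%N.
Proof.
elim: n k => [|n IH] [|k] //; first by rewrite bin0 expn_gt0.
by rewrite binS expnS mul2n -addnn leq_add.
Qed.

Lemma geom_le_hasse rho G C E k : 0 < rho -> 0 <= C -> 0 <= E ->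
  geom_le rho G C E -> geom_le rho (hasse G k) (C * (2 * E) ^+ k) (2 * E).
Proof.
move=> r0 C0 E0 hG i; have CE : 0 <= C * E ^+ (i + k) by rewrite mulr_ge0
  ?exprn_ge0.
apply: (norm_le_le (norm_leMn 'C(i + k, k) r0 (hG _))).
rewrite -mulrA -exprD [(k + i)%N]addnC exprMn mulrCA -[leLHS]mulr_natl ler_wpM2r //.
by rewrite -natrX ler_nat leq_bin_expn.
Qed.

(** Binomials are at most 2^(i + k), so passing to Hasse derivatives doubles E; then 2 E g <= 1/2
    makes the evaluated series geometric. *)
Lemma geom_le_tshift rho G C E w g : 0 < rho -> 0 <= C -> 0 <= E -> w 0 = 0 ->
  norm_le rho w g -> 4 * E * g <= 1 ->
  geom_le rho G C E -> geom_le rho (tshift G w) (2 * C) (2 * E).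
Proof.
move=> r0 C0 E0 w0 hw Eg hG k; have g0 := norm_le_ge0 hw; rewrite -mulrA.
have Ck : 0 <= C * (2 * E) ^+ k by rewrite mulr_ge0 // exprn_ge0 // mulr_ge0.
apply: norm_le_ev_geometric => // i.
apply: (norm_le_le (norm_leM r0 (geom_le_hasse k r0 C0 E0 hG i) (norm_leX i r0
  hw))).
rewrite -mulrA ler_wpM2l // -exprMn lerXn2r ?nnegrE ?mulr_ge0 ?invr_ge0 //; lra.
Qed.

Lemma norm_le_finite rho s (r : seq rat) : 0 < rho ->
  (forall q, s q != 0 -> q \in r) -> exists C, norm_le rho s C.
Proof.
move=> r0; elim: r s => [|x r IH] s hs.
  exists 0; rewrite (_ : s = 0); first exact: norm_le0.
  by apply: lcseries_eq => q; rewrite lcc0; apply/eqP; apply: contraT => /hs.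
have [|C hC] := IH (s - lcmono (s x) x).
  move=> q; rewrite lccB /=; case: (eqVneq q x) => [->|qx] /=; last first.
    by rewrite subr0 => /hs; rewrite inE (negbTE qx).
  by case: leP => [|/lcc_lt0 ->]; rewrite ?subrr ?subr0 ?eqxx.
exists (C + normc (s x) * ratpow rho x).
by have := norm_leD r0 hC (@norm_le_mono _ rho (s x) x); rewrite subrK.
Qed.

End Convergence.

Section RootConvergence.
Variable R : realType.
Local Notation K := R[i].
Local Notation lc := (lcseries K).
Implicit Types (s t u v w g : lc) (F G H : nat -> lc) (b c d e h p q : rat).
Implicit Types (rho C D E : R) (z : K) (k i n : nat).

(** Majorant argument: on a small radius, [ev G] maps the ball of norm y into itself, and the
    iterates started at 0 stay in it. Shrinking the radius makes the constant and linear
    coefficients small, while the bounds on the others persist. *)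
Lemma fixpoint_bounded rho1 G w C0 C1 D E : 0 < rho1 -> 0 <= D -> 0 <= E ->
  w 0 = 0 -> w = ev G w -> G 0%N 0 = 0 -> G 1%N 0 = 0 ->
  norm_le rho1 (G 0%N) C0 -> norm_le rho1 (G 1%N) C1 ->
  (forall i, (2 <= i)%N -> norm_le rho1 (G i) (D * E ^+ i)) ->
  exists rho, 0 < rho <= rho1 /\ exists C, norm_le rho w C.
Proof.
move=> r1 D0 E0 w0 hw G0 G1 hG0 hG1 hG.
(* The choice of X gives E y <= 1/2 and D E^2 y <= 1/8, so that the i-th term has norm at most (y /
   2) 2^-i. *)
pose X := 2 * E + 8 * D * E ^+ 2 + 1; pose y := X^-1.
have E2 : 0 <= E ^+ 2 by rewrite exprn_ge0.
have DE2 : 0 <= D * E ^+ 2 by rewrite mulr_ge0.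
have X0 : 0 < X by rewrite /X; lra.
have y0 : 0 < y by rewrite invr_gt0.
have Xy : X * y = 1 by rewrite mulfV // gt_eqF.
have Ey : 0 <= E * y <= 2^-1.
  rewrite mulr_ge0 ?(ltW y0) //=.
  have : 0 <= D * E ^+ 2 * y by rewrite mulr_ge0 // ltW.
  move: Xy; rewrite /X; lra.
have Dy : D * E ^+ 2 * y <= 8^-1.
  have : 0 <= E * y by rewrite mulr_ge0 // ltW.
  move: Xy; rewrite /X; lra.
have [|r2 /andP[r20 r21] hr2] := norm_le_small r1 G0 hG0 (E := y / 2); first by lra.
have [|r3 /andP[r30 r31] hr3] := norm_le_small r1 G1 hG1 (E := 4^-1); first by lra.
pose rho := Num.min r2 r3.
have r0 : 0 < rho by rewrite lt_min r20.
have r_r1 : rho <= rho1 by rewrite ge_min r21.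
exists rho; split; first by rewrite r0.
exists y; apply: norm_le_local => b; exists (lctrunc b w); split;
  last exact: vge_trunc.
apply: (fixpoint_ind (S := fun v => norm_le rho v y) w0 hw G1);
  first exact/norm_le0/ltW.
move=> v {}b v0 hv; apply: norm_le_trunc => //.
apply: (@norm_le_le _ _ _ (2 * (y / 2))); last by lra.
apply: norm_le_ev_geometric => // [|i]; first by lra.
case: i => [|[|i]].
- rewrite mulr1; apply: (norm_le_le (hr2 rho _)); last by rewrite expr0 mulr1.
  by rewrite r0 ge_min lexx.
- rewrite expr1; apply: (norm_le_le (norm_leM r0 (hr3 rho _) hv)).
    by rewrite r0 ge_min lexx orbT.
  by rewrite expr1; lra.
apply: (norm_le_le (norm_leM r0 (norm_le_radius r0 r_r1 (hG i.+2 isT)) (norm_leX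
  i.+2 r0 hv))).
have -> : D * E ^+ i.+2 * y ^+ i.+2 = (D * E ^+ 2 * y) * y * (E * y) ^+ i.
  by rewrite exprMn -[i.+2]addn2 !exprD; ring.
have -> : y / 2 * 2^-1 ^+ i.+2 = 8^-1 * y * 2^-1 ^+ i.
  by rewrite -[i.+2]addn2 exprD; field.
case/andP: Ey => Ey0 Ey; apply: ler_pM.
- by rewrite !mulr_ge0 // ltW.
- by rewrite exprn_ge0.
- by rewrite ler_wpM2r // ltW.
- by rewrite lerXn2r ?nnegrE // invr_ge0.
Qed.

(* With e the order of F_x(gamma) and gamma0 the truncation of gamma at e + 1,*)
(* gamma = gamma0 + t^e w where w solves an equation to which the implicit    *)
(* function theorem applies, and whose coefficients only involve F and the    *)
(* finitely many terms of gamma0.                                             *)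
Lemma simple_root_convergent rho0 F g C E : 0 < rho0 -> 0 <= C -> 0 <= E ->
  geom_le rho0 F C E -> (forall i, den 1 (F i)) -> g 0 = 0 -> ev F g = 0 ->
  tshift F g 1 != 0 ->
  exists N, [/\ (0 < N)%N, den N g & exists rho D, 0 < rho /\ norm_le rho g D].
Proof.
move=> r00 C0 E0 hF dF g0 Fg /order_exists[e [e0 he ve]].
(* Cutting one beyond e keeps the derivative at gm of order exactly e and gives w order at least
   1. *)
pose b := e + 1; have b0 : 0 < b by rewrite ltr_wpDl.
pose gm := lctrunc b g; have gm0 : gm 0 = 0 by rewrite /gm /= b0.
have vb : vge b (g - gm) by apply: vge_trunc.
have [w hw] := vge_divt e0 (vge_le vb (ltW (ltr_pwDr ltr01 (lexx e)))).
have w1 : vge 1 w by apply: (vge_t_iff e0); rewrite -hw.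
have w0 : w 0 = 0 by apply: w1.
have gE : g = gm + 't^e * w by rewrite -hw subrKC.
pose G := tshift F gm.
have G1d : vge b (G 1%N - tshift F g 1).
  by apply: ev_continuous => //; rewrite -opprB; apply: vgeN.
have eb : e < b by rewrite ltrDl.
have vG1 : vge e (G 1%N).
  by rewrite -(subrK (tshift F g 1) (G 1%N)); apply: vgeD => //;
    apply: (vge_le G1d); apply: ltW.
have [d1 hd1] := vge_divt e0 vG1.
have d10 : d1 0 != 0.
  rewrite -(lcc_t_at d1 e0) -hd1 -(subrK (tshift F g 1) (G 1%N)) lccD.
  by rewrite (G1d e eb) add0r.
have e20 : 0 <= 2%:R * e by rewrite mulr_ge0.
have FG : ev G ('t^e * w) = 0.
  by rewrite -hw /G -taylor_sub.
(* From F(g) = 0, the constant coefficient is minus the linear term, of order at least e + b = 2 e +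
   1, up to terms of order at least 2 b. *)
have vG0 : vge (2%:R * e + 1) (G 0%N).
  have := evP G 2 b0 vb; rewrite hw FG /psum !big_ord_recr big_ord0 /= mulr1
    expr1 => h.
  have -> : G 0%N = - (0 - (0 + G 0%N + G 1%N * ('t^e * w))) - G 1%N * ('t^e * w)
    by ring.
  rewrite add0r in h; rewrite add0r; apply: vgeB; first by apply: vgeN;
    apply: (vge_le h); rewrite /b; lra.
  by rewrite -hw; apply: (vge_le (vgeM vG1 vb)); rewrite /b; lra.
have [d0 hd0] := vge_divt e20 (vge_le vG0 (ler_wpDr ler01 (lexx _))).
have d00 : d0 0 = 0.
  have : vge 1 d0 by apply: (vge_t_iff e20); rewrite -hd0.
  by apply.
(* The coefficients of F(gm + t^e w) divided by t^(2 e): d 0 vanishes at 0 and d 1 does not. *)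
pose d i : lc := if i is i'.+2 then 't^(i'%:R * e) * G i else if i is 1%N then d1
  else d0.
have hd i : 't^(i%:R * e) * G i = 't^(2%:R * e) * d i.
  case: i => [|[|i]]; first by rewrite mul0r mul1r.
    by rewrite mul1r /= hd1 mulrA -tD // mulr_natl mulr2n.
  by rewrite /d mulrA -tD ?mulr_ge0 // -mulrDl -natrD add2n.
have dw : ev d w = 0.
  apply: (tI e20); rewrite mulr0 -(@ev_scale _ G d e 0 (2%:R * e)) ?FG ?mulr0 //
    => i.
  by rewrite t0 mul1r.
pose T := newton d (d 1%N 0).
have hT : w = ev T w by rewrite /T ev_newton // dw mulr0 subr0.
have T0 : T 0%N 0 = 0 by apply: newton_at0.
have T1 : T 1%N 0 = 0 by apply: newton_at0.
have [r hr] : exists r : seq rat, forall q, gm q != 0 -> q \in r.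
  have [r _ hr] := left_finite_le b (lcseriesP g); exists r => q; rewrite /gm /=.
  by case: ltP => [/ltW qb|]; rewrite ?eqxx // => sq; apply: hr.
have [N N0 hN] := common_denominator (e :: r).
have eN : e * N%:R \is a Num.int by apply: hN; rewrite inE eqxx.
have keN k : (k%:R * e) * N%:R \is a Num.int by rewrite -mulrA rpredM // rpred_nat.
have dgm : den N gm by move=> q /hr qr; apply: hN; rewrite inE qr orbT.
have dG i : den N (G i).
  by apply: den_tshift => // j; rewrite -[N]mul1n; apply: den_dvd.
have dd i : den N (d i).
  apply: (den_divt e20); first exact: (keN 2%N).
  by rewrite -hd; apply: denM => //; apply: den_mono.
have dT i : den N (T i).
  apply: denD; first by case: ifP => _; [apply: den_mono;
    rewrite mul0r|apply: den0].
  by apply: denN; apply: denM => //; apply: den_mono; rewrite mul0r.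
have dw' : den N w.
  apply: den_local => a; exists (lctrunc a w); split; last exact: vge_trunc.
  apply: (fixpoint_ind (S := den N) w0 hT T1); first exact: den0.
  by move=> v a' v0 dv; apply: den_trunc; apply: den_ev.
exists N; split => //.
  by rewrite gE; apply: denD => //; apply: denM => //; apply: den_mono.
have [Cg hCg] := norm_le_finite r00 hr.
have E1 : 0 < (4 * E + 1)^-1 by rewrite invr_gt0 ltr_wpDl // mulr_ge0.
have [r1 /andP[r10 r1r0] hr1] := norm_le_small r00 gm0 hCg E1.
(* A radius at most 1 makes the monomials t^(i e) in d harmless. *)
pose rho1 := Num.min 1 r1.
have rho10 : 0 < rho1 by rewrite lt_min ltr01.
have rho11 : rho1 <= 1 by rewrite ge_min lexx.
have rho1r : 0 < rho1 <= r1 by rewrite rho10 ge_min lexx orbT.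
have hF1 : geom_le rho1 F C E.
  by move=> i; apply: (norm_le_radius rho10 _ (hF i));
    apply: le_trans (proj2 (andP rho1r)) r1r0.
have Eg : 4 * E * (4 * E + 1)^-1 <= 1.
  by rewrite ler_pdivrMr ?mul1r ?lerDl // ltr_wpDl // mulr_ge0.
have hG := geom_le_tshift rho10 C0 E0 gm0 (hr1 _ rho1r) Eg hF1.
pose a := normc (d 1%N 0)^-1; have a0 : 0 <= a by apply: normc_ge0.
have na : norm_le rho1 (lcmono (d 1%N 0)^-1 0) a.
  by have := norm_le_mono rho1 (d 1%N 0)^-1 0; rewrite ratpow0 mulr1.
have hd0' := norm_le_divt rho10 e20 (eq_ind _ (fun s => norm_le rho1 s _) (hG
  0%N) _ hd0).
have hd1' := norm_le_divt rho10 e0 (eq_ind _ (fun s => norm_le rho1 s _) (hG 1%N)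
  _ hd1).
have nN s D : norm_le rho1 s D -> norm_le rho1 (- s) D.
  move=> hs; apply: (norm_le_dom rho10 hs) => q.
  by rewrite lccN -[- _]mulN1r ComplexField.Normc.normcM (@normcN R 1)
    ComplexField.Normc.normc1 mul1r.
have nT0 := norm_leD rho10 (@norm_le0 _ rho1 0 (lexx 0)) (nN _ _ (norm_leM rho10
  na hd0')).
have nT1 := norm_leD rho10 (@norm_le1 _ rho1) (nN _ _ (norm_leM rho10 na hd1')).
have nT i : (2 <= i)%N -> norm_le rho1 (T i) ((a * (2 * C)) * (2 * E) ^+ i).
  case: i => [|[|i]] // _; rewrite /T /newton /= sub0r -mulrA; apply: nN.
  apply: (norm_leM rho10 na).
  have ie : 0 <= i%:R * e by rewrite mulr_ge0.
  apply: (norm_le_le (norm_leM rho10 (norm_le_mono rho1 1 (i%:R * e)) (hG i.+2))).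
  rewrite ComplexField.Normc.normc1 mul1r ler_piMl ?ratpow_le1 ?rho10 //.
  exact: norm_le_ge0 (hG i.+2).
have [||rho [/andP[rr0 rr1] [D hD]]] :=
  fixpoint_bounded rho10 _ _ w0 hT T0 T1 nT0 nT1 nT.
- by rewrite !mulr_ge0.
- by rewrite mulr_ge0.
exists rho; eexists; split => //; rewrite gE.
apply: (norm_leD rr0); last exact: (norm_leM rr0 (norm_le_mono rho 1 e) hD).
by apply: (norm_le_radius rr0 _ (hr1 _ rho1r)).
Qed.

(** If k + 1 is the multiplicity of g as a root of F, then g is a simple root of the k-th Hasse
    derivative. *)
Lemma root_convergent rho0 F g C E m : 0 < rho0 -> 0 <= C -> 0 <= E ->
  geom_le rho0 F C E -> (forall i, den 1 (F i)) -> F m 0 != 0 ->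
  g 0 = 0 -> ev F g = 0 ->
  exists N, [/\ (0 < N)%N, den N g & exists rho D, 0 < rho /\ norm_le rho g D].
Proof.
move=> r0 C0 E0 hF dF Fm g0 Fg.
have [|k hk kmin] := @ex_minnP (fun k => tshift F g k != 0).
  exists m; apply: contraNneq Fm => h; have := @ev_at0 _ (hasse F m) g g0.
  by rewrite -/(tshift F g m) h lcc0 /hasse add0n binn => <-.
case: k hk kmin => [|k] hk kmin; first by move: hk; rewrite tshift0 Fg eqxx.
apply: (@simple_root_convergent rho0 (hasse F k) g (C * (2 * E) ^+ k) (2 * E)) =>
  //.
- by rewrite mulr_ge0 // exprn_ge0 // mulr_ge0.
- by rewrite mulr_ge0.
- exact: geom_le_hasse.
- by move=> i; apply: denMn.
- apply/eqP; apply: contraT => h; have := kmin k; rewrite -ltnS ltnn.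
  by move=> ->.
have -> : tshift (hasse F k) g 1 = tshift F g k.+1 *+ k.+1.
  rewrite /tshift -evMn //; apply: eq_ev => i;
    rewrite /hasse -!mulrnA addn1 bin1 addnS addSn.
  congr (_ *+ _); rewrite mulnC [RHS]mulnC mul_bin_left.
  by rewrite -addSn addnK.
apply: contraNneq hk => h; apply/eqP/lcseries_eq => q.
have := congr1 (fun s : lc => s q) h; rewrite lccMn !lcc0 => /eqP.
by rewrite mulrn_eq0 /= => /eqP.
Qed.

End RootConvergence.

(** * Polynomials and their derivatives *)

Section DerivativeRoots.
Variable K : numClosedFieldType.
Implicit Types (P : {poly K}) (a b z : K).

Lemma size_deriv_char0 P : size P^`() = (size P).-1.
Proof.
have [->|P0] := eqVneq P 0; first by rewrite deriv0 size_poly0.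
case E: (size P) => [|[|n]] /=; first by move/eqP: E;
  rewrite size_poly_eq0 (negbTE P0).
  by apply/eqP; rewrite size_poly_eq0 (size1_polyC (eq_leq E)) derivC.
apply/anti_leq/andP; split; first by rewrite -ltnS -E lt_size_deriv.
rewrite ltnNge; apply/negP => /leq_sizeP/(_ n (leqnn n))/eqP.
rewrite coef_deriv mulrn_eq0 /= (_ :
  P`_n.+1 = lead_coef P) ?lead_coef_eq0 ?(negbTE P0) //.
by rewrite lead_coefE E.
Qed.

Lemma deriv_neq0 P a : P != 0 -> root P a -> P^`() != 0.
Proof.
move=> P0 Pa; have := root_size_gt1 P0 Pa; apply: contraTneq => dP.
by have := size_deriv_char0 P; rewrite dP size_poly0; case: (size P) => [|[|]].
Qed.

(* P / gcd(P, P') has the same roots as P and is coprime to P' / gcd(P, P'),  *)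
(* whose degree is one less.                                                  *)
Lemma deriv_root_not_root P a b : P != 0 -> root P a -> root P b -> a != b ->
  exists2 z, root P^`() z & ~~ root P z.
Proof.
move=> P0 Pa Pb ab; pose D := gcdp P P^`().
have D0 : D != 0 by rewrite gcdp_eq0 negb_and P0.
pose U := P %/ D; pose V := P^`() %/ D.
have PE : U * D = P by rewrite divpK // dvdp_gcdl.
have dPE : V * D = P^`() by rewrite divpK // dvdp_gcdr.
have UV : coprimep U V by apply: coprimep_div_gcd; rewrite P0.
have U0 : U != 0 by apply: contraNneq P0 => U0; rewrite -PE U0 mul0r.
have rootU z : root P z -> root U z.
  (* If U(z) were nonzero, the full power (X - z)^m would divide D, hence P', contradicting that m
     is the exact multiplicity in characteristic zero. *)
  move=> Pz; apply: contraT => Uz; have [m [Q]] := multiplicity_XsubC P z.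
  rewrite P0 /= => Qz PQ; have m0 : (0 < m)%N.
    rewrite lt0n; apply: contraTneq Pz => m0.
    by rewrite PQ m0 expr0 mulr1.
  have dvD : ('X - z%:P) ^+ m %| D.
    rewrite -(@Gauss_dvdpr _ _ U) ?PE ?PQ ?dvdp_mull //.
    by rewrite coprimep_expl // coprimep_sym coprimep_XsubC.
  have : ('X - z%:P) ^+ m %| P^`() by apply: dvdp_trans dvD (dvdp_gcdr _ _).
  rewrite PQ derivM (dvdp_addr _ (dvdp_mull _ (dvdpp _))) deriv_exp derivXsubC.
  rewrite mul1r mulrnAr -mulrnAl -{1}(prednK m0) exprS dvdp_mul2r; last first.
    by rewrite expf_neq0 // polyXsubC_eq0.
  by rewrite dvdp_XsubCl /root hornerMn mulrn_eq0 -/(root Q z) (negbTE Qz) orbF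
    eqn0Ngt m0.
have sU : (2 < size U)%N.
  have := @max_poly_roots _ U [:: a; b] U0; apply; last by rewrite /= inE ab.
  by rewrite /= !rootU.
have V0 : V != 0.
  apply: contraTneq sU => V0; rewrite -leqNgt.
  have := size_deriv_char0 P; rewrite -dPE V0 mul0r size_poly0 -PE.
  rewrite size_mul //.
  have : (0 < size D)%N by rewrite size_poly_gt0.
  move: (size U) (size D) => [|[|[|u]]] [|d] //=; lia.
have [z Vz] : exists z, root V z.
  apply/closed_rootP; have := size_deriv_char0 P.
  rewrite -dPE -PE !size_mul //; have : (0 < size D)%N by rewrite size_poly_gt0.
  move: sU; case: (size U) (size V) (size D) => [|[|[|u]]] [|[|v]] [|d] //=; lia.
exists z; first by rewrite -dPE rootM Vz.
by apply/negP => /rootU Uz; move: Vz; rewrite /root (negbTE (coprimep_root UV Uz)).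
Qed.

(** If a were the only root, P would be a multiple of (X - a)^n, whose derivative vanishes at most
    at a, and a is not 0. *)
Lemma second_root P a : ~~ root P 0 -> root P^`() 0 -> root P a ->
  exists2 b, b != a & root P b.
Proof.
move=> P0 dP Pa; have [r Pr] := closed_field_poly_normal P.
have Pn0 : P != 0 by apply: contraNneq P0 => ->; rewrite root0.
have rP b : root P b = (b \in r).
  by rewrite Pr rootZ ?lead_coef_eq0 // root_prod_XsubC.
have [/allP ra|] := boolP (all (pred1 a) r); last first.
  by case/allPn => b br /= ba; exists b => //; rewrite rP.
exfalso; have a0 : a != 0 by apply: contraNneq P0 => <-.
have n0 : (0 < size r)%N by move: Pa; rewrite rP; case: (r).
have rn : r = nseq (size r) a by apply/all_pred1P/allP.
move/negP: dP; apply; rewrite Pr rn big_nseq iter_mulr_1 derivZ deriv_exp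
  derivXsubC mul1r.
rewrite rootZ ?lead_coef_eq0 // /root hornerMn horner_exp hornerXsubC sub0r.
by apply/negP; rewrite mulrn_eq0 negb_or -lt0n n0 expf_neq0 // oppr_eq0.
Qed.

End DerivativeRoots.

(** * Germs and polar quotients *)

Section Germs.
Variable R : realType.
Local Notation K := R[i].
Local Notation lc := (lcseries K).
Implicit Types (s t u v w : lc) (F G H : nat -> lc) (b d e h p q : rat).
Implicit Types (rho C D E : R) (z : K) (f g : nat -> nat -> K) (i j n N : nat).

Fact germ_series_subproof f i :
  left_finite (fun q => if q \is a Num.nat then f i (Num.truncn q) else 0).
Proof.
split=> [q q0|b].
  by case: ifP => // /natr_ge0; rewrite leNgt q0.
exists [seq j%:R | j <- iota 0 (Num.bound `|b|)] => q qb.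
case: ifP => [/natrP[n qn] _|]; last by rewrite eqxx.
rewrite {}qn in qb *; apply/mapP; exists n => //;
  rewrite mem_iota /= add0n -(ltr_nat rat).
by apply: lt_trans qb _; apply: le_lt_trans (ler_norm b) _; apply: archi_boundP.
Qed.

(* The coefficient of x^i in the germ f, as a series in y. *)
Definition germ_series f i : lc := LCSeries (germ_series_subproof f i).

Lemma germ_series_nat f i j : germ_series f i j%:R = f i j.
Proof. by rewrite /= natr_nat natrK. Qed.

Lemma germ_series_neq0 f i q : germ_series f i q != 0 -> exists j : nat, q = j%:R.
Proof. by rewrite /=; case: ifP => [/natrP|]; rewrite ?eqxx. Qed.

Lemma germ_series_den1 f i : den 1 (germ_series f i).
Proof. by move=> q /germ_series_neq0[j ->]; rewrite mulr1 rpred_nat. Qed.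

Lemma germ_series_partial_x f i :
  germ_series (partial_x f) i = hasse (germ_series f) 1 i.
Proof.
apply: lcseries_eq => q; rewrite /hasse lccMn addn1 bin1 /= /partial_x.
by case: ifP => //; rewrite mul0rn.
Qed.

Lemma series_expE s n : series_exp s n = s ^+ n.
Proof.
elim: n => [|n IH]; apply/funext => q; first by rewrite lcc1.
by rewrite /series_exp iterS -/(series_exp s n) IH exprS.
Qed.

(** Only a finite rectangle of monomials x^i y^j contributes to the coefficient at q: i is bounded
    because s has positive order, j because exponents are nonnegative. *)
Lemma series_substE f s : s 0 = 0 -> series_subst f s = ev (germ_series f) s.
Proof.
move=> /vge_pos0[e e0 se]; apply/funext => q.
have [n hn] := rat_archi q e0; have [J hJ] := rat_archi q (ltr01 : 0 < 1 :> rat).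
rewrite mulr1 in hJ.
have -> : ev (germ_series f) s q = psum (germ_series f) s n q.
  by apply/eqP; rewrite -subr_eq0 -lccB; apply/eqP/(evP _ n e0 se).
rewrite /series_subst (fsbigE [seq (i, j) | i <- iota 0 n, j <- iota 0 J]).
- rewrite big_mkcond /= -/(index_iota 0 n).
  under eq_bigr do rewrite in_setT series_expE.
  rewrite big_allpairs /= -{1}(subn0 n) -/(index_iota 0 n) big_mkord lcc_sum.
  apply: eq_bigr => i _; rewrite lccM (@conv_seq _ [seq j%:R | j <- iota 0 J]).
  + by rewrite big_map; apply: eq_bigr => j _; rewrite germ_series_nat.
  + by rewrite map_inj_uniq ?iota_uniq // => x y /eqP; rewrite eqr_nat => /eqP.
  move=> p /germ_series_neq0[j ->] sj; apply/mapP; exists j => //.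
  rewrite mem_iota /= add0n -(ltr_nat rat); apply: le_lt_trans hJ.
  by have := left_finite_ge0 (lcseriesP (s ^+ i)) sj; rewrite subr_ge0.
- by rewrite allpairs_uniq ?iota_uniq // => -[x y] [x' y'] _ _ /= [-> ->].
- by move=> x.
move=> [i j] _ ij; rewrite series_expE /=.
have [iin|iin] := boolP (i \in iota 0 n); last first.
  rewrite (vgeX se) ?mulr0 //; move: iin; rewrite mem_iota add0n /= -leqNgt => ni.
  rewrite ltrBlDr; apply: lt_le_trans hn _; apply: le_trans (ler_natM e0 ni) _.
  by rewrite lerDl.
have [jin|] := boolP (j \in iota 0 J).
  by case/negP: ij; apply/allpairsP; exists (i, j).
rewrite mem_iota add0n /= -leqNgt => Jj; rewrite lcc_lt0 ?mulr0 //.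
by rewrite subr_lt0; apply: lt_le_trans hJ _; rewrite ler_nat.
Qed.

Lemma convergent_puiseux_lcseries (x : rat -> K) : convergent_puiseux x ->
  (forall q, x q != 0 -> 0 < q) -> exists2 s : lc, x = s & s 0 = 0.
Proof.
move=> [N N0 [hN _]] x0; have N0' : 0 < N%:R :> rat by rewrite ltr0n.
have lx : left_finite x.
  split=> [q q0|b].
    by apply/eqP; apply: contraT => /x0 /lt_trans/(_ q0); rewrite ltxx.
  exists [seq j%:R / N%:R | j <- iota 0 (Num.bound `|b * N%:R|)] => q qb xq.
  have [n qn] := hN q xq; apply/mapP; exists n => //; rewrite mem_iota add0n /=.
  rewrite -(ltr_nat rat); move: qb; rewrite qn ltr_pdivrMr // => qb.
  by apply: lt_trans qb _; apply: le_lt_trans (ler_norm _) _; apply: archi_boundP.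
exists (LCSeries lx) => //=; apply/eqP; apply: contraT => /x0; by rewrite ltxx.
Qed.

Lemma lcseries_convergent_puiseux N rho D s : (0 < N)%N -> den N s -> 0 < rho ->
  norm_le rho s D -> convergent_puiseux s.
Proof.
move=> N0 dN r0 hs; exists N => //; have N0' : 0 < N%:R :> rat by rewrite ltr0n.
split=> [q sq|].
  have q0 := left_finite_ge0 (lcseriesP s) sq.
  have : q * N%:R \is a Num.nat by rewrite natrEint dN //= mulr_ge0 // ltW.
  move=> /natrP[n qn]; exists n.
  by rewrite -qn mulfK // gt_eqF.
(* A radius rho in y is a radius rho^(1/N) in y^(1/N). *)
exists (ratpow rho N%:R^-1); first exact: ratpow_gt0.
apply: (@le_lt_trans _ _ D%:E); last exact: ltry.
apply: ge_ereal_sup => _ [A [finA _] <-].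
rewrite fsbig_finite //= sumEFin lee_fin.
have := hs [seq n%:R / N%:R | n : nat <- finmap.enum_fset (fset_set A)].
rewrite map_inj_uniq; last first.
  by move=> x y /(mulIf (invr_neq0 (lt0r_neq0 N0')))/eqP; rewrite eqr_nat => /eqP.
rewrite big_map => /(_ (finmap.fset_uniq _)); congr (_ <= _).
apply: eq_bigr => n _; congr (_ * _).
by rewrite /ratpow -powR_mulrn ?powR_ge0 // -powRrM rmorphM /= ratr_nat mulrC.
Qed.

Lemma analytic_germ_bound f : analytic_germ f ->
  exists C E, [/\ 0 <= C, 0 <= E & forall i j, normc (f i j) <= C * E ^+ (i + j)].
Proof.
move=> [e e0 he]; set S := esum _ _ in he.
have S0 : (0 <= S)%E.
  by apply: esum_ge0 => p _; rewrite lee_fin mulr_ge0 ?normc_ge0 // exprn_ge0 //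
    ltW.
have Sf : S \is a fin_num by rewrite ge0_fin_numE.
exists (fine S), e^-1; split; rewrite ?invr_ge0 ?(ltW e0) ?fine_ge0 // => i j.
rewrite exprVn ler_pdivlMr ?exprn_gt0 // -lee_fin fineK //.
apply: esum_ge; exists [set (i, j)] => /=; first by split.
by rewrite fsbig_set1.
Qed.

Lemma germ_series_geom f C E : 0 <= C -> 0 <= E ->
  (forall i j, normc (f i j) <= C * E ^+ (i + j)) ->
  exists rho, 0 < rho /\ geom_le rho (germ_series f) (2 * C) E.
Proof.
move=> C0 E0 hf; pose rho := (2 * E + 1)^-1.
have X0 : 0 < 2 * E + 1 by rewrite ltr_wpDl // mulr_ge0.
have r0 : 0 < rho by rewrite invr_gt0.
have Er : 0 <= E * rho <= 2^-1.
  rewrite mulr_ge0 ?(ltW r0) //=;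
    have : (2 * E + 1) * rho = 1 by rewrite mulfV // gt_eqF.
  lra.
exists rho; split => // i; rewrite -mulrA; apply: norm_le_local => b.
have [J hJ] := rat_archi b (ltr01 : 0 < 1 :> rat); rewrite mulr1 in hJ.
exists (\sum_(j < J) lcmono (f i j) j%:R); split.
  have := norm_le_sum J r0 (fun j => norm_le_mono rho (f i j) j%:R).
  move=> /norm_le_le; apply; apply: (@geometric_sum _ (fun j => normc (f i j) *
    ratpow rho j%:R)).
    move=> j; apply: (@le_trans _ _ (C * E ^+ (i + j) * ratpow rho j%:R)).
      by rewrite ler_wpM2r // ltW // ratpow_gt0.
    rewrite /ratpow ratr_nat powR_mulrn ?(ltW r0) // exprD mulrA -[leLHS]mulrA
      -exprMn.
    case/andP: Er => Er0 Er; rewrite ler_wpM2l ?mulr_ge0 ?exprn_ge0 //.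
    by rewrite lerXn2r ?nnegrE // invr_ge0.
  by rewrite mulr_ge0 // exprn_ge0.
move=> q qb; rewrite lccB lcc_sum; apply/eqP; rewrite subr_eq0; apply/eqP.
have [[j qj]|nq] := pselect (exists j : nat, q = j%:R).
  rewrite qj germ_series_nat; have jJ : (j < J)%N.
    by rewrite -(ltr_nat rat) -qj (lt_trans qb).
  rewrite (bigD1 (Ordinal jJ)) //= eqxx ler0n big1 ?addr0 // => k kj.
  by rewrite eqr_nat ifF //; apply/negbTE; rewrite negb_and eq_sym kj.
rewrite big1 => [|k _]; last first.
  by rewrite /= ifF //; apply/negP => /andP[/eqP qk _]; apply: nq; exists k.
by apply/eqP; apply: contra_notT nq => /germ_series_neq0.
Qed.

(** Formal roots converge automatically; the nonzero pure power x^m supplies the regularity needed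
    in [root_convergent]. *)
Lemma newton_puiseux_rootE g s C E m : 0 <= C -> 0 <= E ->
  (forall i j, normc (g i j) <= C * E ^+ (i + j)) -> g m 0%N != 0 -> s 0 = 0 ->
  newton_puiseux_root g s <-> ev (germ_series g) s = 0.
Proof.
move=> C0 E0 hg gm s0; split=> [[_ _ hs]|hs].
  by apply: lcseries_eq => q; rewrite -series_substE // hs lcc0.
have [rho [r0 hG]] := germ_series_geom C0 E0 hg.
have gm' : germ_series g m 0 != 0 by rewrite -[0]/(0%:R) germ_series_nat.
have [|N [N0 dN [r [D [r0' hD]]]]] :=
  root_convergent r0 _ E0 hG (@germ_series_den1 g) gm' s0 hs.
  by rewrite mulr_ge0.
split; first exact: lcseries_convergent_puiseux N0 dN r0' hD.
  move=> q sq; rewrite lt_neqAle (left_finite_ge0 (lcseriesP s) sq) andbT.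
  by apply: contraNneq sq => <-; rewrite s0.
by move=> q; rewrite series_substE // hs lcc0.
Qed.

Lemma series_ordE s h : vge h s -> s h != 0 -> series_ord s = h%:E.
Proof.
move=> hs sh; rewrite /series_ord;
  case: xgetP => [ord _ [q [-> sq hq]]|/(_ h%:E) []].
  congr _%:E; apply/le_anti; rewrite hq //=; rewrite leNgt; apply/negP => qh.
  by rewrite hs ?eqxx in sq.
exists h; split => // p sp; rewrite leNgt; apply/negP => ph.
by rewrite hs ?eqxx in sp.
Qed.

(** Exceptional values lie among the roots of P, and two generic values must agree because the field
    is infinite. *)
Lemma generic_valueE (F : K -> \bar rat) (o : \bar rat) (P : {poly K}) : P != 0 ->
  (forall z, ~~ root P z -> F z = o) -> generic_value F = o.
Proof.
move=> P0 hF; have fin : finite_set [set z | F z != o].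
  have [r Pr] := closed_field_poly_normal P.
  apply: (@sub_finite_set _ _ [set` r]); last exact: finite_seq.
  move=> z /= Fz; have : root P z by apply: contraNT Fz => /hF ->.
  by rewrite Pr rootZ ?lead_coef_eq0 // root_prod_XsubC.
rewrite /generic_value; case: xgetP => [ord' _ /= fin'|/(_ o) //].
apply/eqP; apply: contraT => oo'.
have /finite_seqP[r hr] : finite_set ([set z | F z != o] `|` [set z | F z != ord']).
  by rewrite finite_setU.
have : (size [seq n%:R : K | n <- iota 0 (size r).+1] <= size r)%N.
  apply: uniq_leq_size.
    by rewrite map_inj_uniq ?iota_uniq // => x y /eqP; rewrite eqr_nat => /eqP.
  move=> z _; have : [set` r] z; last by [].
  rewrite -hr /=; have [Fz|] := eqVneq (F z) o; last by left.
  by right; rewrite Fz eq_sym.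
by rewrite size_map size_iota ltnn.
Qed.

Lemma approximationE s h z : 0 < h -> exists2 w : lc,
  Defs.approximation s h z = s + 't^h * w & w 0 = z - s h.
Proof.
move=> h0; have h0' := ltW h0; pose t := lctrunc h s + lcmono z h.
have tE : Defs.approximation s h z = t.
  apply/funext => q; rewrite /Defs.approximation /t lccD /= h0' andbT.
  by case: (ltgtP q h) => _; rewrite ?addr0 ?add0r.
have vt : vge h (t - s).
  by move=> q qh; rewrite lccB lccD /= qh lt_eqF //= addr0 subrr.
have [w hw] := vge_divt h0' vt; exists w; first by rewrite tE -hw subrKC.
by rewrite -(lcc_t_at w h0') -hw lccB lccD /= ltxx eqxx h0' add0r.
Qed.

End Germs.

(** * Newton edges, polar branches and approximations *)

Section PolarQuotients.
Variable R : realType.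
Local Notation K := R[i].
Local Notation lc := (lcseries K).
Implicit Types (s t u v w phi : lc) (F G H : nat -> lc) (b d e h p q rho : rat).
Implicit Types (z : K) (f g : nat -> nat -> K) (P : {poly K}).

(* The initial form of F_x at phi is the derivative of that of F, shifted by  *)
(* one power of t^rho.                                                        *)
Lemma newton_data F phi rho m : F m 0 != 0 -> phi 0 = 0 -> 0 < rho ->
  exists h P, [/\ 0 <= h, P != 0,
    forall w, vge h (ev F (phi + 't^rho * w)) /\ ev F (phi + 't^rho * w) h = P.[w
      0],
    forall z, root P z -> exists2 w : lc, w 0 = z & ev F (phi + 't^rho * w) = 0 &
    (forall w, ('t^rho * ev (hasse F 1) (phi + 't^rho * w)) h = P^`().[w 0]) /\
    forall z, P^`() != 0 -> root P^`() z ->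
      exists2 w : lc, w 0 = z & ev (hasse F 1) (phi + 't^rho * w) = 0].
Proof.
move=> Fm phi0 r0; have r0' := ltW r0; pose G := tshift F phi.
have tw0 w : ('t^rho * w) 0 = 0 by apply: (vge_t w r0' r0).
have [|h [H [P [h0 P0 hG hP]]]] := @initial_form _ G rho r0.
  exists m; apply: contraNneq Fm => Gm; have := ev_at0 (hasse F m) phi0.
  by rewrite -/(tshift F phi m) -/G Gm lcc0 /hasse add0n binn => <-.
have hG0 (i : nat) : 't^0 * 't^(i%:R * rho) * G i = 't^h * H i by rewrite t0
  mul1r hG.
pose H1 (i : nat) : lc := H i.+1 *+ i.+1.
have hG1 (i : nat) : 't^rho * 't^(i%:R * rho) * hasse G 1 i = 't^h * H1 i.
  have := hG i.+1; rewrite /hasse addn1 bin1 !mulrnAr => <-.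
  by rewrite -tD ?mulr_ge0 // -[i.+1%:R]natr1 mulrDl mul1r [rho + _]addrC.
have hP1 (i : nat) : P^`()`_i = H1 i 0 by rewrite coef_deriv hP lccMn.
have evE w : ev F (phi + 't^rho * w) = ev G ('t^rho * w) by rewrite taylor.
have ev1E w : ev (hasse F 1) (phi + 't^rho * w) = ev (hasse G 1) ('t^rho * w).
  by rewrite taylor //; apply: eq_ev => i; rewrite hasse1_tshift.
exists h, P; split => //.
- move=> w; rewrite evE.
  by have := ev_scale_lead w r0 (lexx 0) h0 hG0 hP; rewrite t0 mul1r.
- move=> z Pz; have [w w0 hw] := newton_step_root r0 (lexx 0) h0 hG0 hP P0 Pz.
  by exists w; rewrite ?evE.
split=> [w|z dP0 dPz].
  by rewrite ev1E; have [] := ev_scale_lead w r0 r0' h0 hG1 hP1.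
have [w w0 hw] := newton_step_root r0 r0' h0 hG1 hP1 dP0 dPz.
by exists w; rewrite ?ev1E.
Qed.

(** The contact order is rho because u and v differ at 0. The approximation with constant z is phi +
    t^rho times a series of constant term z + a, so its order is h unless P(z + a) = 0. *)
Lemma approximation_ordE f phi u v rho h P : 0 < rho -> phi 0 = 0 ->
  u 0 != v 0 -> P != 0 ->
  (forall w, vge h (ev (germ_series f) (phi + 't^rho * w)) /\
     ev (germ_series f) (phi + 't^rho * w) h = P.[w 0]) ->
  approximation_ord f (phi + 't^rho * u) (phi + 't^rho * v) = h%:E.
Proof.
move=> r0 phi0 uv P0 hP; have r0' := ltW r0; rewrite /approximation_ord.
set s := phi + _; set t := phi + _.
have stE : s - t = 't^rho * (u - v) by rewrite /s /t; ring.
have -> : contact_order s t = rho.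
  rewrite /contact_order (_ : s \- t = lccoef (s - t)) //.
  rewrite (@series_ordE _ _ rho) //; first by rewrite stE; apply: vge_t.
  by rewrite stE lcc_t_at // lccB subr_eq0.
pose a := u 0 - s rho.
apply: (@generic_valueE _ _ _ (P \Po ('X + a%:P))).
  apply: contraNneq P0 => Pa.
  by rewrite -(comp_polyXaddC_K P a) Pa comp_poly0.
move=> z; rewrite /root horner_comp hornerD hornerX hornerC => Pz.
have [w -> w0] := approximationE s z r0.
have sE : s + 't^rho * w = phi + 't^rho * (u + w) by rewrite /s; ring.
have [hv hc] := hP (u + w); rewrite sE series_substE.
  apply: series_ordE => //; rewrite hc lccD w0.
  by have -> : u 0 + (z - s rho) = z + a by rewrite /a; ring.
by rewrite lccD phi0 add0r; apply: (vge_t _ r0' r0).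
Qed.

End PolarQuotients.

Theorem theorem3p1 (R : realType) (f : nat -> nat -> R[i]) (m r : nat)
    (xi : 'I_r -> rat -> R[i])
    (f_analytic : analytic_germ f)
    (f_origin : f 0%N 0%N = 0)
    (f_regular : mini_regular f m)
    (r_ge2 : (2 <= r)%N)
    (xi_distinct : injective xi)
    (xi_roots : forall s : rat -> R[i],
       newton_puiseux_root f s <-> exists i : 'I_r, s = xi i) :
  polar_quotients f =
  [set o : \bar rat | exists i j : 'I_r,
     (i < j)%N /\ o = approximation_ord f (xi i) (xi j)].
Proof.
have fm : f m 0%N != 0.
  case: f_regular => _; rewrite /homogeneous_part big_ord_recr /= subnn expr1n.
  rewrite expr0 !mulr1 big1 ?add0r // => i _.
  by rewrite expr0n subn_eq0 leqNgt ltn_ord mulr0.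
have m0 : (0 < m)%N by rewrite lt0n; apply: contraNneq fm => ->; rewrite f_origin.
have [C [E [C0 E0 hf]]] := analytic_germ_bound f_analytic.
pose F := germ_series f.
have Fm : F m 0 != 0 by rewrite -[0]/(0%:R) germ_series_nat.
have rootf (s : lcseries R[i]) : s 0 = 0 ->
  newton_puiseux_root f (lccoef s) <-> ev F s = 0.
  by move=> s0; exact: (newton_puiseux_rootE C0 E0 hf fm s0).
have rootdf (s : lcseries R[i]) : s 0 = 0 ->
  polar_branch f (lccoef s) <-> ev (hasse F 1) s = 0.
  move=> s0; rewrite -(eq_ev s (germ_series_partial_x f)).
  (* The factor i + 1 from differentiation is absorbed by 2^(i + j + 1). *)
  apply: (@newton_puiseux_rootE _ _ _ (C * (2 * E)) (2 * E) m.-1) => //.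
  - by rewrite !mulr_ge0.
  - by rewrite mulr_ge0.
  - move=> i j; rewrite /partial_x normc_mulrn -[leLHS]mulr_natl.
    rewrite -mulrA -exprS exprMn mulrCA -addSn; apply: ler_pM.
    + by [].
    + exact: normc_ge0.
    + rewrite -natrX ler_nat; apply: leq_trans (ltnW (ltn_expl _ (ltnSn 1))) _.
      by rewrite leq_pexp2l // leq_addr.
    + exact: hf.
  by rewrite /partial_x prednK // mulrn_eq0 negb_or -lt0n m0.
have hX i : exists x : lcseries R[i], [/\ xi i = x, x 0 = 0 & ev F x = 0].
  have xr : newton_puiseux_root f (xi i) by apply/xi_roots; exists i.
  have [xc xp _] := xr; have [x xE x0] := convergent_puiseux_lcseries xc xp.
  by exists x; split => //; apply/(rootf _ x0); rewrite -xE.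
have {hX}[X hX] := choice hX.
apply/seteqP; split=> [_ [s [sp snf] <-]|_ [i [j [ij ->]]]]; last first.
  (* Two roots yield a polar branch: at the base X i with slope the contact order, they correspond
     to the roots 0 and v 0 of P. *)
  have [xiE xi0 Fi] := hX i; have [xjE xj0 Fj] := hX j.
  have /order_exists[rho [r0' hr vr]] : X j - X i != 0.
    rewrite subr_eq0; apply: contraTneq ij => Xij.
    by rewrite (_ : i = j) ?ltnn //; apply: xi_distinct; rewrite xiE xjE Xij.
  have r0 : 0 < rho.
    by rewrite lt_neqAle r0' andbT; apply: contraNneq hr => <-;
      rewrite lccB xi0 xj0 subrr.
  have [v hv] := vge_divt r0' vr.
  have v0 : v 0 != 0 by rewrite -(lcc_t_at v r0') -hv.
  have XjE : X j = X i + 't^rho * v by rewrite -hv subrKC.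
  have XiE : X i = X i + 't^rho * 0 by rewrite mulr0 addr0.
  have [h [P [h0 P0 hP _ [_ hdP]]]] := newton_data Fm xi0 r0.
  have P00 : root P 0.
    by apply/rootP; have := (hP 0).2; rewrite mulr0 addr0 Fi !lcc0 => <-.
  have Pv : root P (v 0) by apply/rootP; rewrite -(hP v).2 -XjE Fj lcc0.
  have [z dPz Pz] : exists2 z, root P^`() z & ~~ root P z.
    by apply: (deriv_root_not_root P0 P00 Pv); rewrite eq_sym.
  have dP0 : P^`() != 0 by exact: deriv_neq0 P0 P00.
  have [w w0 hw] := hdP z dP0 dPz.
  have s0 : (X i + 't^rho * w) 0 = 0.
    by rewrite lccD xi0 add0r; apply: (vge_t w r0' r0).
  have [vF cF] := hP w; rewrite w0 in cF.
  exists (X i + 't^rho * w); first split.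
  - exact/rootdf.
  - by move/(rootf _ s0) => Fs; case/negP: Pz; apply/rootP; rewrite -cF Fs lcc0.
  rewrite xiE xjE XjE [X in approximation_ord _ (lccoef X)]XiE.
  rewrite (approximation_ordE r0 xi0 _ P0 hP) ?lcc0 1?eq_sym //.
  by rewrite series_substE //; apply: series_ordE; rewrite // cF.
have [sc spos _] := sp; have [g gE g0] := convergent_puiseux_lcseries sc spos.
rewrite {}gE in sp snf sc spos *.
have Fg : ev F g != 0 by apply/eqP => h; apply/snf/rootf.
have hd k : exists d : rat, [/\ 0 < d, (X k - g) d != 0 & vge d (X k - g)].
  have [_ xk0 Fk] := hX k.
  have /order_exists[d [d0 hd vd]] : X k - g != 0.
    by rewrite subr_eq0; apply: contraNneq Fg => <-; rewrite Fk.
  exists d; split=> //; rewrite lt_neqAle d0 andbT; apply: contraNneq hd => <-.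
  by rewrite lccB xk0 g0 subrr.
have {hd}[d hd] := choice hd.
have i0 : 'I_r by exact: Ordinal (ltnW r_ge2).
(* The base is now the polar branch g, and the slope is its largest contact order with a root of
   f. *)
have [k _ kmax] := @Order.TotalTheory.arg_maxP _ _ _ i0 xpredT d isT.
have [r0 hr vr] := hd k; set rho := d k in kmax r0 hr vr; have r0' := ltW r0.
have [h [P [h0 P0 hP hroot [hdP _]]]] := newton_data Fm g0 r0.
have gr : g + 't^rho * 0 = g by rewrite mulr0 addr0.
have tw0 (w : lcseries R[i]) : (g + 't^rho * w) 0 = 0.
  by rewrite lccD g0 add0r; apply: (vge_t w r0' r0).
have lift (z : R[i]) : root P z -> exists l, exists2 w : lcseries R[i],
    w 0 = z & X l = g + 't^rho * w.
  move=> /hroot[w w0 hw]; have /rootf := hw; move=> /(_ (tw0 w))/xi_roots[l lE].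
  exists l, w => //; apply: lcseries_eq => q.
  by rewrite lE; have [-> _ _] := hX l.
have [u hu] := vge_divt r0' vr.
have u0 : u 0 != 0 by rewrite -(lcc_t_at u r0') -hu.
have Pu : root P (u 0).
  apply/rootP; rewrite -(hP u).2 -hu subrKC; have [_ _ ->] := hX k.
  by rewrite lcc0.
(* A root of f lifting 0 would have contact greater than rho with g. *)
have nP0 : ~~ root P 0.
  apply/negP => /lift[l [w w0 Xl]]; have [d0 hl vl] := hd l.
  have XlE : X l - g = 't^rho * w by rewrite Xl addrC addKr.
  have dl : d l <= rho := kmax l isT.
  case/eqP: hl; move: dl; rewrite le_eqVlt XlE => /orP[/eqP ->|dl].
    by rewrite lcc_t_at.
  by rewrite lcc_t // lcc_lt0 // subr_lt0.
have dP0 : root P^`() 0.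
  apply/rootP; have := hdP 0; rewrite gr lcc0 => <-.
  by have /rootdf -> := sp; rewrite ?mulr0 ?lcc0.
have [b bu Pb] := second_root nP0 dP0 Pu.
have [i1 [w1 w10 X1]] := lift _ Pu; have [i2 [w2 w20 X2]] := lift _ Pb.
have ordg : series_ord (series_subst f g) = h%:E.
  rewrite series_substE //; have [vF cF] := hP 0; rewrite gr in vF cF.
  by apply: series_ordE => //; rewrite cF lcc0.
have approx (j1 j2 : 'I_r) (v1 v2 : lcseries R[i]) : v1 0 != v2 0 ->
  X j1 = g + 't^rho * v1 -> X j2 = g + 't^rho * v2 ->
    approximation_ord f (xi j1) (xi j2) = h%:E.
  move=> v12 X1E X2E; have [-> _ _] := hX j1; have [-> _ _] := hX j2.
  by rewrite X1E X2E; apply: approximation_ordE r0 g0 v12 P0 hP.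
(* The roots found come in no prescribed order; equal indices would force u 0 = b. *)
rewrite /= ordg; case: (ltngtP i1 i2) => i12.
- by exists i1, i2; split=> //; rewrite (approx _ _ w1 w2) // w10 w20 eq_sym.
- by exists i2, i1; split=> //; rewrite (approx _ _ w2 w1) // w10 w20.
exfalso; case/eqP: bu; rewrite -w10 -w20.
have w12 : X i1 = X i2 by congr X; apply: val_inj.
by move: w12; rewrite X1 X2 => /addrI/(tI r0') ->.
Qed.
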